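(* Let $p$ be a prime, let $0<\varepsilon\leq \frac34$ be a real number, and let $\alpha$ be the unique positive root of the cubic $4x^3+(12-4\varepsilon)x^2+(9-4\varepsilon)x+(8\varepsilon-7)$. Let $A\subseteq\mathbb{Z}/p\mathbb{Z}$ be a nonempty subset and write $|2A|=2|A|+r$. Suppose that $$|2A|\leq (2+\alpha)|A|-3\qquad\text{and}\qquad |2A|\leq \varepsilon p.$$ Then there exist arithmetic progressions $P_A,P_{2A}\subseteq \mathbb{Z}/p\mathbb{Z}$ with the same common difference such that $A\subseteq P_A$, $|P_A|\leq |A|+r+1$, $P_{2A}\subseteq 2A$, and $|P_{2A}|\geq 2|A|-1$.
   Context: For $A\subseteq \mathbb{Z}/p\mathbb{Z}$, $2A=A+A=\{x+y: x,y\in A\}$. An arithmetic progression in $\mathbb{Z}/p\mathbb{Z}$ with difference $g\neq 0$ is a set of the form $\{a, a+g, a+2g,\dots,a+(k-1)g\}$ with $1\le k\le p$. *)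

(* Defs.v *)
From HB Require Import structures.
From mathcomp Require Import all_boot all_order all_algebra.
Set Implicit Arguments. Unset Strict Implicit. Unset Printing Implicit Defensive.
Import Order.TTheory GRing.Theory Num.Theory.
Local Open Scope ring_scope.

Definition sumset (p : nat) (A : {set 'F_p}) : {set 'F_p} :=
  [set x + y | x in A, y in A].

Definition is_AP (p : nat) (P : {set 'F_p}) (g : 'F_p) : Prop :=
  g != 0 /\ exists (a : 'F_p) (k : nat),
    (1 <= k <= p)%N /\ P = [set a + g *+ (nat_of_ord i) | i : 'I_k].

Definition cubic (R : rcfType) (eps x : R) : R :=
  4 * x ^+ 3 + (12 - 4 * eps) * x ^+ 2 + (9 - 4 * eps) * x + (8 * eps - 7).

(* Main.v *)
(* Proof idea.  Let n = |A| and s = |2A|.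

   Concentration.  Comparing the additive energy (at least n^4/s by
   Cauchy-Schwarz) with the fourth moment of the Fourier transform of A gives a
   coefficient of size M with M^2 >= n^3 (p - s) / (s (p - n)).  Then some
   progression with at most (p + 1)/2 terms contains a subset B of A with
   2|B| - n >= M, and the cubic is exactly the condition making s <= 3|B| - 4.

   Integers.  B is Freiman isomorphic to a set of integers, so Freiman's 3k-4
   theorem puts B into a progression with at most s - |B| + 1 terms, and 2B
   contains one with 2|B| - 1 terms.

   Duality.  Hence the complement D of 2A lies in a progression with
   p - 2|B| + 1 terms, D - B has no wrap-around, and D - B avoids A.  The two-set
   version of the interval theorem applied to (D, -B) yields a progression with
   |D| + |B| - 1 terms avoiding A, so A itself lies in a progression with at most
   (p + 1)/2 terms, and the 3k-4 theorem applies to A. *)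
Require Import Defs.
From HB Require Import structures.
From mathcomp Require Import all_boot all_order all_algebra.
From mathcomp Require Import zify ring lra.
From mathcomp Require reals trigo Rstruct.
Import Order.TTheory GRing.Theory Num.Theory.
Set Implicit Arguments.
Unset Strict Implicit.
Unset Printing Implicit Defensive.
Local Open Scope ring_scope.

(** * Counting functions and sumsets of sets of natural numbers *)

Section IntegerSets.
Local Open Scope nat_scope.

Definition cnt (P : pred nat) (n : nat) : nat := count P (iota 0 n).

Definition sums (X Y : pred nat) : pred nat :=
  fun t => has (fun x => X x && Y (t - x)) (iota 0 t.+1).

Lemma sumsP (X Y : pred nat) (t : nat) :
  reflect (exists x y, [/\ X x, Y y & t = x + y]) (sums X Y t).
Proof.
apply: (iffP hasP) => [[x]|[x [y [Xx Yy ->]]]].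
  by rewrite mem_iota => /andP[_ lex] /andP[Xx Yx]; exists x, (t - x); split=> //; lia.
exists x; first by rewrite mem_iota; lia.
by rewrite Xx addKn.
Qed.

Lemma sumsI (X Y : pred nat) (x y : nat) : X x -> Y y -> sums X Y (x + y).
Proof. by move=> Xx Yy; apply/sumsP; exists x, y. Qed.

Lemma cntS (P : pred nat) (n : nat) : cnt P n.+1 = cnt P n + P n.
Proof. by rewrite /cnt -addn1 iotaD count_cat /= add0n addn0. Qed.

Lemma cntD (P : pred nat) (n d : nat) :
  cnt P (n + d) = cnt P n + cnt (fun i => P (n + i)) d.
Proof. by elim: d => [|d IHd]; rewrite ?addn0 // addnS !cntS IHd addnA. Qed.

(** Counts are compared on the window [[m, n)]; the additive form avoids truncated subtraction. *)
Lemma cnt_homo (P Q : pred nat) (m n : nat) : m <= n ->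
  (forall i, m <= i < n -> P i -> Q i) -> cnt P n + cnt Q m <= cnt Q n + cnt P m.
Proof.
move=> /subnKC <-; elim: (n - m) => [|d IHd] sPQ; first by rewrite addn0; lia.
have := IHd (fun i H => sPQ i ltac:(lia)); rewrite addnS !cntS.
by have /implyP := sPQ (m + d) ltac:(lia); case: (P _); case: (Q _) => //=; lia.
Qed.

Lemma cnt_sub (P Q : pred nat) (n : nat) :
  (forall i, i < n -> P i -> Q i) -> cnt P n <= cnt Q n.
Proof.
move=> sPQ; have := @cnt_homo P Q 0 n isT (fun i H => sPQ i ltac:(lia)).
by rewrite /cnt /=; lia.
Qed.

Lemma eq_cnt (P Q : pred nat) (n : nat) :
  (forall i, i < n -> P i = Q i) -> cnt P n = cnt Q n.
Proof.
by move=> eqPQ; apply/eqP; rewrite eqn_leq !cnt_sub // => i lti; rewrite eqPQ.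
Qed.

Lemma leq_cnt (P : pred nat) (m n : nat) : m <= n -> cnt P m <= cnt P n.
Proof. by move=> /subnKC <-; rewrite cntD leq_addr. Qed.

Lemma cnt_leq (P : pred nat) (n : nat) : cnt P n <= n.
Proof. by rewrite -[leqRHS](size_iota 0) count_size. Qed.

Lemma cnt_lip (P : pred nat) (m n : nat) : m <= n -> cnt P n <= cnt P m + (n - m).
Proof. by move=> /subnKC {1}<-; rewrite cntD leq_add2l cnt_leq. Qed.

Lemma cntC (P : pred nat) (n : nat) : cnt P n + cnt (predC P) n = n.
Proof. by rewrite count_predC size_iota. Qed.

Lemma cntUI (P Q : pred nat) (n : nat) :
  cnt (predU P Q) n + cnt (predI P Q) n = cnt P n + cnt Q n.
Proof. exact: count_predUI. Qed.

Lemma cnt0 (P : pred nat) (n : nat) : (forall i, i < n -> ~~ P i) -> cnt P n = 0.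
Proof.
elim: n => // n IHn P0.
by rewrite cntS IHn ?(negbTE (P0 _ _)) // => i lti; apply/P0/ltnW.
Qed.

Lemma cnt_disj (P Q : pred nat) (n : nat) :
  (forall i, i < n -> P i -> ~~ Q i) -> cnt P n + cnt Q n = cnt (predU P Q) n.
Proof.
move=> dPQ; rewrite -cntUI (@cnt0 (predI P Q)) ?addn0 // => i lti /=.
by apply/negP => /andP[/(dPQ _ lti)/negP].
Qed.

Lemma cnt_rev (P : pred nat) (n : nat) : cnt (fun i => P (n - i)) n.+1 = cnt P n.+1.
Proof.
elim: n => [|n IHn]; first by rewrite !cntS subn0.
rewrite [RHS]cntS -IHn -[n.+2]add1n cntD cntS /= subn0 addnC; congr (_ + _).
Qed.

(** If [z] is not a sum, the reflection [i -> z - i] of [Y] within [[0, z]] avoids [X], so both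
    counts fit into [z + 1] places. *)
Lemma notin_sums_low (X Y : pred nat) (z : nat) :
  ~~ sums X Y z -> cnt X z.+1 + cnt Y z.+1 <= z.+1.
Proof.
move=> nz; rewrite -(cnt_rev Y) cnt_disj ?cnt_leq // => i lti Xi.
by apply: contra nz => Yi; apply/sumsP; exists i, (z - i); split => //; lia.
Qed.

(** The same argument on the window [[z, L]], with the reflection [i -> z + L - i]. *)
Lemma notin_sums_high (X Y : pred nat) (L z : nat) : z <= L ->
  ~~ sums X Y (z + L) ->
  cnt X L.+1 + cnt Y L.+1 + z <= cnt X z + cnt Y z + L.+1.
Proof.
move=> /subnKC; set d := L - z => <- nz; rewrite -addnS !cntD.
have: cnt (fun i => X (z + i)) d.+1 + cnt (fun i => Y (z + i)) d.+1 <= d.+1; last by lia.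
rewrite -(cnt_rev (fun i => Y (z + i))) cnt_disj ?cnt_leq // => i lti Xi.
by apply: contra nz => Yi; apply/sumsP; exists (z + i), (z + (d - i)); split => //; lia.
Qed.

Lemma cnt_sums_split (X Y : pred nat) (L : nat) (a b : pred nat) :
  (forall i, a i = (i < L) && ~~ sums X Y i) ->
  (forall i, b i = ~~ sums X Y (i + L)) ->
  cnt (sums X Y) (2 * L).+1 + cnt a L.+1 + cnt b L.+1 = (2 * L).+1.
Proof.
move=> aE bE; rewrite mul2n -addnn -addnS cntD.
(* [a] is false at [L], so the gaps below [L] and those from [L] on can both be counted up to
   [L.+1]. *)
have -> : cnt a L.+1 = cnt (predC (sums X Y)) L.
  by rewrite cntS aE ltnn addn0; apply: eq_cnt => i lti; rewrite aE lti.
have -> : cnt b L.+1 = cnt (predC (fun i => sums X Y (L + i))) L.+1.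
  by apply: eq_cnt => i lti; rewrite bE /= addnC.
by have := cntC (sums X Y) L; have := cntC (fun i => sums X Y (L + i)) L.+1; lia.
Qed.

(** * Sums of two dense integer sets: their size and the long interval they contain *)

Section DenseSums.
Variables (X Y : pred nat) (L : nat).
Hypotheses (X0 : X 0) (XL : X L).
Hypothesis dense : L + 3 <= cnt X L.+1 + cnt Y L.+1.

Let a : pred nat := fun i => (i < L) && ~~ sums X Y i.
Let b : pred nat := fun i => ~~ sums X Y (i + L).
Let N : pred nat := predC Y.

(** Two gaps [z] and [z + L] would give, by the low and high bounds whose windows share only [z], at
    most [L + 2] elements in all. *)
Lemma dense_cover (z : nat) : z < L -> sums X Y z || sums X Y (z + L).
Proof.
move=> ltz; apply: contraT; rewrite negb_or => /andP[/notin_sums_low nz].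
move=> /(notin_sums_high (ltnW ltz)) nzL; move: nz; rewrite !cntS; move: dense nzL; lia.
Qed.

Let abN (z : nat) : z < L.+1 -> a z || b z -> N z.
Proof.
rewrite /a /b /N /= => lez; apply: contraL => Yz; rewrite negb_or negb_and !negbK.
by rewrite -{2}[z]add0n sumsI // orbT addnC sumsI.
Qed.

Let ab_disj (z : nat) : z < L.+1 -> a z -> ~~ b z.
Proof.
move=> lez /andP[ltz nz]; rewrite /b negbK.
by move: (dense_cover ltz); rewrite (negbTE nz).
Qed.

(** As [X] contains 0 and [L], both [Y] and [L + Y] consist of sums; so [a] and [b] are disjoint
    sets of non-elements of [Y]. *)
Lemma dense_sums_size : L + cnt Y L.+1 <= cnt (sums X Y) (2 * L).+1.
Proof.
have := @cnt_sums_split X Y L a b (fun=> erefl) (fun=> erefl).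
have := @cnt_disj a b L.+1 (fun i Hi => ab_disj Hi); have := @cnt_sub (predU a b) N L.+1 (fun i Hi => abN Hi).
by have := cntC Y L.+1; rewrite -/N; lia.
Qed.

(* Take a crossing pair [tau < t] at minimal distance: no gap of [X + Y] lies
   strictly between them, whereas the two counting bounds force many elements
   outside [Y] there, so there are too few gaps left for [X + Y] to be small. *)
Lemma dense_no_crossing (tau t : nat) :
  cnt (sums X Y) (2 * L).+1 + 4 <= cnt X L.+1 + 2 * cnt Y L.+1 ->
  tau < t -> t < L.+1 -> b tau -> ~~ a t.
Proof.
move=> small; elim/ltn_ind: {t}(t - tau) {-2}tau {-2}t (erefl (t - tau)) => d IHd {}tau t dE ltt leL btau.
apply/negP => at_.
have noab z : tau.+1 <= z < t -> predU a b z -> xpred0 z.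
  move=> /andP[ltz zlt] /orP[az|bz].
    by have := IHd (z - tau) ltac:(lia) tau z erefl ltz ltac:(lia) btau; rewrite az.
  by have := IHd (t - z) ltac:(lia) z t erefl zlt leL bz; rewrite at_.
have c1 := @cnt_homo _ _ tau.+1 t ltt noab.
have c2 : cnt (predU a b) tau.+1 <= cnt N tau.+1.
  by apply: cnt_sub => i lti; apply: abN; lia.
have c3 : cnt (predU a b) L.+1 + cnt N t <= cnt N L.+1 + cnt (predU a b) t.
  by apply: cnt_homo => [|i lti]; [lia|apply: abN; lia].
have z0 n : cnt xpred0 n = 0 by exact: cnt0.
rewrite !z0 in c1.
have := @cnt_sums_split X Y L a b (fun=> erefl) (fun=> erefl).
have := @cnt_disj a b L.+1 (fun i Hi => ab_disj Hi).
have htau := @notin_sums_high X Y L tau ltac:(lia) btau.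
have ht := @notin_sums_low X Y t ltac:(by case/andP: at_).
have := cntC Y L.+1; have := cntC Y tau; have := cntC Y t; have := cntC Y t.+1.
have Nt : N t by apply: abN; rewrite ?at_.
have Ntau : N tau by apply: abN; rewrite ?btau ?orbT //; lia.
have := @leq_cnt X tau t.+1 ltac:(lia).
rewrite -/N; rewrite (cntS N tau) Ntau (cntS N t) Nt in c2 *.
move: small dense htau ht c1 c2 c3; lia.
Qed.

Lemma dense_long_interval :
  cnt (sums X Y) (2 * L).+1 + 4 <= cnt X L.+1 + 2 * cnt Y L.+1 ->
  exists u, forall i, i < cnt X L.+1 + cnt Y L.+1 - 1 -> sums X Y (u + i).
Proof.
move=> small.
(* [t - 1] is the last gap below [L] and [v + L] the first one from [L] on, with [t = 0] and
   [v = L.+1] as defaults; nothing is missing in between. *)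
have [t [let1 ht at0 at1]] : exists t, [/\ t <= L, cnt X t + cnt Y t <= t,
    forall i, t <= i < L -> sums X Y i & t = 0 \/ a t.-1].
  have exP : exists t, (t <= L) && all (sums X Y) (iota t (L - t)).
    by exists L; rewrite leqnn subnn.
  case: (ex_minnP exP) => t /andP[let1 /allP allt] tmin.
  have at1 : t = 0 \/ a t.-1.
    case: t let1 allt tmin => [|t] let1 allt tmin; [by left|right].
    rewrite /a let1; apply: contraT; rewrite negbK => st.
    suff /tmin : (t <= L) && all (sums X Y) (iota t (L - t)) by rewrite ltnn.
    rewrite ltnW //= ; apply/allP => i; rewrite mem_iota => lti.
    by case: (eqVneq i t) => [-> //|neq]; apply: allt; rewrite mem_iota; lia.
  exists t; split=> // [|i lti]; last by apply: allt; rewrite mem_iota; lia.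
  case: at1 => [->|]; first by rewrite /cnt.
  by case: t {let1 allt tmin} => [|t] /=; [rewrite /cnt|case/andP=> _ /notin_sums_low].
have [v [leLv hv bv bv1]] : exists v, [/\ v <= L.+1,
    cnt X L.+1 + cnt Y L.+1 + v <= cnt X v + cnt Y v + L.+1,
    forall i, i < v -> sums X Y (i + L) & v = L.+1 \/ b v].
  have exP : exists v, b v || (v == L.+1) by exists L.+1; rewrite eqxx orbT.
  case: (ex_minnP exP) => v bv vmin.
  have leL : v <= L.+1 by apply: vmin; rewrite eqxx orbT.
  exists v; split=> //.
  - case/orP: bv => [bv|/eqP ->] //; case: (ltnP L v) => [ltv|lev].
      by have -> : v = L.+1 by lia.
    exact: notin_sums_high.
  - by move=> i lti; apply: contraT => nb; have := vmin i; rewrite /b nb => /(_ isT); lia.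
  - by case/orP: bv => [|/eqP]; [right|left].
have letv : t <= v.
  rewrite leqNgt; apply/negP => ltvt.
  case: at1 => [t0|at1]; first by lia.
  case: bv1 => [vL|bv1]; first by lia.
  case: (eqVneq v t.-1) => [vt|neq].
    by move: (ab_disj (z := t.-1) ltac:(lia) at1); rewrite -vt bv1.
  by have := dense_no_crossing (tau := v) (t := t.-1) small ltac:(lia) ltac:(lia) bv1; rewrite at1.
exists t => i lti; case: (ltnP (t + i) L) => [ltL|leL]; first by apply: at0; lia.
rewrite -(subnK leL); apply: bv.
(* On [[t, v)] the two counts grow by at most [2 (v - t)]; with [ht] and [hv] this bounds the length
   [L + v - t] from below. *)
have := cnt_lip X letv; have := cnt_lip Y letv; move: lti ht hv; lia.
Qed.
End DenseSums.

(** * Freiman's 3k-4 theorem for sets of integers *)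

Lemma cnt_shift (P : pred nat) (h n : nat) :
  cnt (fun i => (h <= i) && P (i - h)) (h + n) = cnt P n.
Proof.
rewrite cntD cnt0 => [|i lti]; last by rewrite leqNgt lti.
by rewrite add0n; apply: eq_cnt => i _; rewrite leq_addr addKn.
Qed.

Lemma cnt_ext (P : pred nat) (n n' : nat) :
  n <= n' -> (forall i, P i -> i < n) -> cnt P n' = cnt P n.
Proof.
move=> /subnKC <- ltP; rewrite cntD (@cnt0 (fun i => P (n + i))) ?addn0 // => i _.
by apply/negP => /ltP; lia.
Qed.

Lemma cnt_mem_leq (s : seq nat) (n : nat) : cnt (mem s) n <= size s.
Proof.
rewrite /cnt -size_filter; apply: uniq_leq_size.
  by rewrite filter_uniq ?iota_uniq.
by move=> x; rewrite mem_filter => /andP[].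
Qed.

Lemma cnt_add_list (P Q : pred nat) (n : nat) (s : seq nat) : uniq s ->
  (forall i, Q i -> P i) ->
  {in s, forall x, [/\ x < n, P x & ~~ Q x]} -> cnt Q n + size s <= cnt P n.
Proof.
move=> us sQP sP; have -> : size s = cnt (mem s) n.
  apply/eqP; rewrite eqn_leq cnt_mem_leq andbT /cnt -size_filter.
  apply: uniq_leq_size => // x xs; rewrite mem_filter mem_iota.
  by have [ltx _ _] := sP x xs; rewrite /= xs; lia.
rewrite cnt_disj => [|i lti Qi]; last by apply/negP => /sP[_ _]; rewrite Qi.
by apply: cnt_sub => i lti /orP[/sQP|/sP[]].
Qed.

Lemma sums_leq (X Y : pred nat) (K L t : nat) :
  (forall i, X i -> i <= K) -> (forall i, Y i -> i <= L) -> sums X Y t -> t <= K + L.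
Proof. by move=> XK YL /sumsP[x [y [/XK ? /YL ? ->]]]; lia. Qed.

Lemma sums_sub (X Y X' Y' : pred nat) (t : nat) :
  (forall i, X i -> X' i) -> (forall i, Y i -> Y' i) -> sums X Y t -> sums X' Y' t.
Proof. by move=> sX sY /sumsP[x [y [/sX Xx /sY Yy ->]]]; apply: sumsI. Qed.

Lemma cnt_sums_ge (A : pred nat) (L : nat) : A 0 -> A L ->
  2 * cnt A L.+1 <= cnt (sums A A) (2 * L).+1 + 1.
Proof.
move=> A0 AL; rewrite [in leqRHS]mul2n -addnn -addnS cntD.
have c1 : cnt A L <= cnt (sums A A) L by apply: cnt_sub => i _ Ai; rewrite -[i]addn0 sumsI.
have c2 : cnt A L.+1 <= cnt (fun i => sums A A (L + i)) L.+1.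
  by apply: cnt_sub => i _ Ai; apply: sumsI.
by move: c1 c2; rewrite cntS AL; lia.
Qed.

Definition trunc (A : pred nat) (a : nat) : pred nat := fun i => (i <= a) && A i.

Lemma cnt_trunc (A : pred nat) (a : nat) : cnt (trunc A a) a.+1 = cnt A a.+1.
Proof. by apply: eq_cnt => i lti; rewrite /trunc -ltnS lti. Qed.

Lemma pred_in (A : pred nat) (L : nat) : A 0 -> 0 < L ->
  exists a, [/\ a < L, A a & forall i, A i -> i < L -> i <= a].
Proof.
move=> A0 L0; have exP : exists a, (a < L) && A a by exists 0; rewrite L0.
have ubP a : (a < L) && A a -> a <= L by case/andP; lia.
case: (ex_maxnP exP ubP) => a /andP[lta Aa] amax; exists a; split=> // i Ai ltiL.
by apply: amax; rewrite ltiL.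
Qed.

(** The usual normalisation: minimum 0, maximum [L], gcd 1. *)
Definition normal (A : pred nat) (L : nat) : Prop :=
  [/\ A 0, A L, forall i, A i -> i <= L &
      forall d, 1 < d -> exists i, A i && ~~ (d %| i)].

(** The sparse half of the 3k-4 theorem, isolated for induction on the cardinality. *)
Definition freiman_bound (A : pred nat) (L : nat) : Prop :=
  normal A L -> 2 * cnt A L.+1 <= L + 3 ->
  3 * cnt A L.+1 <= cnt (sums A A) (2 * L).+1 + 3.

Section TopElement.
Variables (A : pred nat) (L a : nat).
Hypotheses (A0 : A 0) (AL : A L) (leAL : forall i, A i -> i <= L).
Hypotheses (ltaL : a < L) (Aa : A a) (amax : forall i, A i -> i < L -> i <= a).

Let A1 := trunc A a.
Let S1 := sums A1 A1.
Let sh : pred nat := fun i => (L <= i) && A1 (i - L).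

Lemma cnt_top : cnt A L.+1 = (cnt A1 a.+1).+1.
Proof.
rewrite cnt_trunc cntS AL addn1; congr _.+1; rewrite -(subnKC ltaL) cntD.
rewrite (@cnt0 (fun i => A (a.+1 + i))) ?addn0 // => i lti; apply/negP => /amax; lia.
Qed.

Let A10 : A1 0. Proof. by rewrite /A1 /trunc A0. Qed.
Let A1a : A1 a. Proof. by rewrite /A1 /trunc leqnn. Qed.
Let A1A (i : nat) : A1 i -> A i. Proof. by case/andP. Qed.
Let A1le (i : nat) : A1 i -> i <= a. Proof. by case/andP. Qed.
Let S1le (i : nat) : S1 i -> i <= 2 * a.
Proof. by move=> /(sums_leq A1le A1le); rewrite addnn mul2n. Qed.

Let cnt_S1 (n : nat) : (2 * a).+1 <= n -> cnt S1 n = cnt S1 (2 * a).+1.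
Proof. by move=> le; apply: cnt_ext => // i /S1le. Qed.

Let cnt_sh : cnt sh (2 * L) = cnt A1 a.+1.
Proof.
rewrite mul2n -addnn cnt_shift; apply: cnt_ext => // i; exact: A1le.
Qed.

Let top_union : cnt (predU S1 sh) (2 * L) < cnt (sums A A) (2 * L).+1.
Proof.
rewrite cntS {3}mul2n -addnn (sumsI AL AL) addn1 ltnS; apply: cnt_sub => i _ /orP[|].
  exact: sums_sub.
by case/andP => leL /A1A Ai; rewrite -(subnKC leL) sumsI.
Qed.

(** Modulo [d] the sets [S1] and [L + A1] are disjoint, which leaves at least [(2 |A1| - 1) + |A1|]
    sums besides [2L]. *)
Lemma top_gcd (d : nat) : 1 < d -> (forall i, A1 i -> d %| i) -> ~~ (d %| L) ->
  3 * cnt A L.+1 <= cnt (sums A A) (2 * L).+1 + 3.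
Proof.
move=> d1 dA dL; have := top_union; rewrite -cnt_disj => [|i _ /sumsP[x [y [Ax Ay ->]]]].
  rewrite cnt_sh cnt_S1 ?cnt_top; last by lia.
  by have := cnt_sums_ge A10 A1a; rewrite -/S1; lia.
apply/negP => /andP[leL /dA dx]; move: dL; rewrite -(dvdn_addl L dx) subnKC //.
by rewrite dvdn_add ?dA.
Qed.

(** [S1] contains an interval of [l] terms starting at [u]. Since [l <= L], the terms lost to
    [L + A1] are no more numerous than the elements of [A1] below [u], which are further elements of
    [S1]; so [S1] minus [L + A1] keeps [l] elements. *)
Lemma top_dense : a + 3 <= 2 * cnt A1 a.+1 -> 2 * cnt A L.+1 <= L + 2 ->
  cnt S1 (2 * a).+1 + 4 <= 3 * cnt A1 a.+1 ->
  3 * cnt A L.+1 <= cnt (sums A A) (2 * L).+1 + 3.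
Proof.
rewrite cnt_top => dense thin small.
pose l := 2 * cnt A1 a.+1 - 1; have lE : l = 2 * cnt A1 a.+1 - 1 by [].
have [u Su] : exists u, forall i, i < l -> S1 (u + i).
  by rewrite /l mul2n -addnn; apply: dense_long_interval => //; rewrite -/S1; lia.
have lu : u + l <= (2 * a).+1 by have /S1le := Su l.-1 ltac:(lia); lia.
pose Q := predD S1 sh.
have Qlow i : i < L -> S1 i -> Q i by move=> ltiL Si; rewrite /Q /= Si /sh leqNgt ltiL.
have cQ : l <= cnt Q (2 * L).
  have cu : cnt A1 u <= cnt Q u.
    apply: cnt_sub => i lti A1i; apply: Qlow; first by lia.
    by rewrite -[i]addn0; apply: sumsI.
  apply: (@leq_trans (cnt Q (u + l))); last by apply: leq_cnt; lia.
  case: (leqP (u + l) L) => [leL|ltL].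
    rewrite cntD; have : cnt xpredT l <= cnt (fun i => Q (u + i)) l.
      by apply: cnt_sub => i lti _; apply: Qlow; [lia|exact: Su].
    by rewrite /cnt count_predT size_iota; lia.
  have -> : u + l = u + ((L - u) + (u + l - L)) by lia.
  rewrite !cntD.
  have c1 : cnt xpredT (L - u) <= cnt (fun i => Q (u + i)) (L - u).
    by apply: cnt_sub => i lti _; apply: Qlow; [lia|apply: Su; lia].
  have c2 : cnt (predC A1) (u + l - L) <=
            cnt (fun i => Q (u + (L - u + i))) (u + l - L).
    apply: cnt_sub => i lti /= nA1; rewrite /Q /= Su ?andbT /sh; last by lia.
    have -> : u + (L - u + i) - L = i by lia.
    by rewrite (negbTE nA1) andbF.
  have c3 := leq_cnt A1 (m := u + l - L) (n := u) ltac:(lia).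
  have := cntC A1 (u + l - L); move: c1; rewrite {1}/cnt count_predT size_iota.
  by lia.
have := top_union; rewrite (@eq_cnt _ (predU sh Q)) => [|i _]; last first.
  by rewrite /Q /=; case: (sh i); case: (S1 i).
rewrite -cnt_disj => [|i _ shi]; last by rewrite /Q /= shi.
by rewrite cnt_sh; lia.
Qed.

(* The third new sum comes from the largest [f] in [A] with [f <> L] modulo [L - a]:
   a sum of two smaller elements equal to [L + f] would have both terms above [f]. *)
Lemma top_gap : a.+1 < L -> (forall d, 1 < d -> exists i, A i && ~~ (d %| i)) ->
  cnt S1 (2 * a).+1 + 3 <= cnt (sums A A) (2 * L).+1.
Proof.
move=> gap gcdA; set d := L - a.
have [f [Af fL fmax]] : exists f, [/\ A f, ~~ (f == L %[mod d]) &
    forall i, A i -> f < i -> i == L %[mod d]].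
  have exP : exists f, A f && ~~ (f == L %[mod d]).
    have [dL|dL] := boolP (d %| L); last first.
      by exists 0; rewrite A0 mod0n eq_sym.
    have [i /andP[Ai di]] := gcdA d ltac:(lia); exists i; rewrite Ai.
    by rewrite (eqP (dL : L %% d == 0)).
  have ubP f : A f && ~~ (f == L %[mod d]) -> f <= L by case/andP => /leAL.
  case: (ex_maxnP exP ubP) => f /andP[Af fL] fmax; exists f; split=> // i Ai ltfi.
  by apply: contraT => iL; have := fmax i; rewrite Ai iL => /(_ isT); lia.
have adL : a == L %[mod d] by rewrite -(subnKC (ltnW ltaL)) -/d modnDr.
have fa : f != a by apply: contraNneq fL => ->.
have fL' : f != L by apply: contraNneq fL => ->.
have ltfa : f < a by have := leAL Af; have := amax Af; lia.
rewrite -(@cnt_S1 (2 * L).+1); last by lia.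
apply: (@cnt_add_list _ _ _ [:: L + L; L + a; L + f]).
- by rewrite /= !inE; lia.
- by move=> i; apply: sums_sub.
move=> x; rewrite !inE => /or3P[] /eqP ->; split; rewrite ?sumsI //; try lia.
- by apply/negP => /S1le; lia.
- by apply/negP => /S1le; lia.
apply/negP => /sumsP[x1 [y1 [/andP[x1a Ax1] /andP[y1a Ay1] eqf]]].
have : (f < x1) && (f < y1) by lia.
move=> /andP[/(fmax _ Ax1) /eqP xL /(fmax _ Ay1) /eqP yL].
have : L + f = L + L %[mod d] by rewrite eqf -modnDm xL yL modnDm.
by move/eqP; rewrite eqn_modDl (negbTE fL).
Qed.
End TopElement.

Definition mirror (A : pred nat) (L : nat) : pred nat := fun i => (i <= L) && A (L - i).

Lemma cnt_sums_mirror (A : pred nat) (L : nat) : (forall i, A i -> i <= L) ->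
  cnt (sums (mirror A L) (mirror A L)) (2 * L).+1 = cnt (sums A A) (2 * L).+1.
Proof.
move=> leAL; rewrite -[RHS]cnt_rev; apply: eq_cnt => t lett.
apply/sumsP/sumsP => -[x [y [Ax Ay xy]]].
  case/andP: Ax Ay => xL Ax /andP[yL Ay].
  by exists (L - x), (L - y); split=> //; lia.
have xL := leAL _ Ax; have yL := leAL _ Ay.
by exists (L - x), (L - y); rewrite /mirror !leq_subr !subKn //; split=> //; lia.
Qed.

Lemma normal_mirror (A : pred nat) (L : nat) : normal A L -> normal (mirror A L) L.
Proof.
case=> A0 AL leAL gcdA; split; rewrite /mirror ?subn0 ?subnn ?leqnn //.
  by move=> i /andP[].
move=> d d1; have [dL|dL] := boolP (d %| L); last by exists L; rewrite leqnn subnn A0.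
have [i /andP[Ai di]] := gcdA d d1; have iL := leAL _ Ai.
exists (L - i); rewrite leq_subr subKn // Ai /=; apply: contra di => di.
by rewrite -(dvdn_addr _ di) subnK.
Qed.

(** Let [A1] be [A] without [L]. A common divisor of [A1] is excluded by [top_gcd]. If [L - 1] were
    missing, [top_gap] would pass the small doubling on to [A1], against the induction hypothesis
    when [A1] is sparse and against [top_dense] otherwise. *)
Lemma freiman_top (A : pred nat) (L : nat) :
  (forall B K, cnt B K.+1 < cnt A L.+1 -> freiman_bound B K) ->
  normal A L -> 2 * cnt A L.+1 <= L + 2 ->
  cnt (sums A A) (2 * L).+1 + 4 <= 3 * cnt A L.+1 -> 0 < L /\ A L.-1.
Proof.
move=> IH [A0 AL leAL gcdA] thin small.
have L0 : 0 < L.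
  have [i /andP[Ai]] := gcdA 2 isT; have := leAL _ Ai; case: (posnP i) => [-> //|]; lia.
split=> //; have [a [ltaL Aa amax]] := pred_in A0 L0.
have cA := cnt_top A0 AL ltaL Aa amax.
have [gcdA1|] := boolP [exists d : 'I_L.+1, (1 < d) && all (fun i => trunc A a i ==> (d %| i)) (iota 0 a.+1)].
  have /existsP[d /andP[d1 /allP dA]] := gcdA1.
  have dA1 i : trunc A a i -> d %| i.
    move=> Ai; have /implyP -> // : trunc A a i ==> (d %| i).
    by apply: dA; case/andP: Ai => lei _; rewrite mem_iota; lia.
  have dL : ~~ (d %| L).
    apply/negP => dL; have [i /andP[Ai /negP[]]] := gcdA d d1.
    have := leAL _ Ai; rewrite leq_eqVlt => /orP[/eqP -> //|ltiL].
    by apply: dA1; rewrite /trunc Ai amax.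
  by have := top_gcd A0 AL ltaL Aa amax d1 dA1 dL; lia.
rewrite negb_exists => /forallP nod.
have nA1 : normal (trunc A a) a.
  split; rewrite /trunc ?leqnn //; first by move=> i /andP[].
  move=> d d1; case: (ltnP d L.+1) => [ltd|led].
    have := nod (Ordinal ltd); rewrite d1 andTb => /allPn[i _].
    by rewrite negb_imply => /andP[Ai di]; exists i; rewrite di andbT.
  have [i /andP[Ai di]] := gcdA d d1.
  have i0 : 0 < i by case: (posnP i) di => // ->; rewrite dvdn0.
  (* If [a = 0], then [A1] is [{0}]: this contradicts [nod] at 2 when [L >= 2], and [thin] when
     [L = 1]. *)
  case: (posnP a) => [a0|a0].
    case: (ltnP 2 L.+1) => [lt2|le2].
      have := nod (Ordinal lt2); rewrite andTb => /allPn[j _].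
      by rewrite negb_imply /trunc a0 leqn0 => /andP[/andP[/eqP -> _]].
    by move: thin small; rewrite cA cnt_trunc a0 cntS A0; lia.
  by exists a; rewrite leqnn Aa /=; apply/negP => /(dvdn_leq a0); lia.
case: (ltnP a.+1 L) => [gap|nogap]; last first.
  by have <- : a = L.-1 by lia.
exfalso; have tg := top_gap A0 AL leAL ltaL Aa amax gap gcdA.
have cS1 : cnt (sums (trunc A a) (trunc A a)) (2 * a).+1 + 4 <= 3 * cnt (trunc A a) a.+1.
  by move: small tg; rewrite cA; lia.
case: (leqP (2 * cnt (trunc A a) a.+1) (a + 3)) => [le|lt].
  by have := IH (trunc A a) a _ nA1 le; rewrite cA => /(_ (leqnn _)); lia.
by have := top_dense A0 AL ltaL Aa amax ltac:(lia) thin cS1; lia.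
Qed.

(** The halves [A] up to [y] and [A] from [w] on overlap in two consecutive elements, so only [2w],
    [w + y] and [2y] can be sums of both. *)
Lemma cnt_sums_split_pair (A : pred nat) (L w y : nat) :
  (forall i, A i -> i <= L) -> w < y -> y <= L ->
  A w -> A y -> (forall i, A i -> i < y -> i <= w) ->
  cnt (sums (trunc A y) (trunc A y)) (2 * y).+1 +
  cnt (sums (fun i => A (w + i)) (fun i => A (w + i))) (2 * (L - w)).+1 <=
  cnt (sums A A) (2 * L).+1 + 3.
Proof.
move=> leAL ltwy leyL Aw Ay wmax.
set S1 := sums _ _; set S2 := sums _ _.
pose S2' : pred nat := fun i => (2 * w <= i) && S2 (i - 2 * w).
have -> : cnt S2 (2 * (L - w)).+1 = cnt S2' (2 * L).+1.
  have -> : (2 * L).+1 = 2 * w + (2 * (L - w)).+1 by lia.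
  by rewrite cnt_shift.
rewrite -(@cnt_ext S1 (2 * y).+1 (2 * L).+1) ?ltnS ?leq_mul2l //; last first.
  move=> i Si; rewrite ltnS mul2n -addnn.
  by apply: (sums_leq _ _ Si) => j /andP[].
rewrite -cntUI; apply: leq_add.
  apply: cnt_sub => i _ /orP[|/andP[lewi /sumsP[x1 [x2 [A1 A2 e]]]]].
    by apply: sums_sub => j /andP[].
  have -> : i = (w + x1) + (w + x2) by lia.
  exact: sumsI.
apply: leq_trans (cnt_mem_leq [:: 2 * w; w + y; 2 * y] (2 * L).+1).
apply: cnt_sub => i _ /andP[/sumsP[x1 [x2 [/andP[y1 A1] /andP[y2 A2] e]]]].
move=> /andP[lewi /sumsP[z1 [z2 [B1 B2 e']]]]; rewrite !inE.
have := wmax _ A1; have := wmax _ A2; have := wmax _ B1; have := wmax _ B2; lia.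
Qed.

(* [2 cnt A x.+1 - x] plays the role of a height: the set is cut at two
   consecutive elements [w < y] where this height makes both halves, which
   share exactly [w] and [y], satisfy the hypothesis of the statement. *)
Lemma freiman_doubling (A : pred nat) (L : nat) : freiman_bound A L.
Proof.
elim/ltn_ind: {A L}(cnt A L.+1) {-2}A {-2}L (erefl (cnt A L.+1)) => m IHm A L mE nA thin3.
have IH B K : cnt B K.+1 < cnt A L.+1 -> freiman_bound B K.
  by rewrite mE => lt; apply: (IHm _ lt).
have [A0 AL leAL gcdA] := nA.
(* In the dense case [thin3] forces [L = 2 |A| - 3], and the bound [L + |A|] is what is wanted. *)
case: (leqP (L + 3) (2 * cnt A L.+1)) => [dense|thin].
  have := @dense_sums_size A A L A0 AL; rewrite addnn -mul2n => /(_ dense); lia.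
case: leqP => // small.
have [L0 AL1] := freiman_top IH nA ltac:(lia) ltac:(lia).
have nR := normal_mirror nA; have cR : cnt (mirror A L) L.+1 = cnt A L.+1.
  rewrite -[RHS]cnt_rev; apply: eq_cnt => i; rewrite ltnS /mirror => ->.
  by [].
(* The same argument for [L - A] puts 1 into [A]. *)
have [_ A1] : 0 < L /\ mirror A L L.-1.
  by apply: freiman_top; rewrite ?cR ?cnt_sums_mirror //; lia.
have {}A1 : A 1 by case/andP: A1 => _; congr (is_true (A _)); lia.
have cA : cnt A L.+1 = (cnt A L).+1 by rewrite cntS AL addn1.
have c2 : 2 <= cnt A 2 by rewrite !cntS A0 A1.
have L3 : 3 <= L.
  have cA2 : cnt A 2 <= cnt A L.+1 by apply: leq_cnt.
  case: (ltnP 1 L) => [lt1|]; last by lia.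
  by have := leq_cnt A lt1; lia.
have exP : exists y, [&& 2 <= y, A y & 2 * cnt A y.+1 <= y + 3].
  by exists L.-1; rewrite AL1 prednK //; lia.
case: (ex_minnP exP) => y /and3P[y2 Ay hy] ymin.
have ltyL : y < L.
  have : y <= L.-1; last by lia.
  by apply: ymin; rewrite AL1 prednK //; lia.
have [w [ltwy Aw wmax]] := pred_in A0 (ltac:(lia) : 0 < y).
have w1 : 1 <= w by apply: wmax => //; lia.
(* This is the sparseness of the half above [w]. It comes from the minimality of [y], or from 0 and
   1 lying in [A] when [w = 1]. *)
have hw : 2 * cnt A L.+1 + w <= 2 * cnt A w.+1 + L + 1.
  case: (ltnP 1 w) => [ltw|lew]; last first.
    have -> : w = 1 by lia.
    by lia.
  have := ymin w; rewrite ltw Aw /=; case: (leqP (2 * cnt A w.+1) (w + 3)) => [_ /(_ isT)|]; lia.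
have cw : cnt A L.+1 = cnt A w + cnt (fun i => A (w + i)) (L - w).+1.
  by rewrite -cntD; congr cnt; lia.
have cw1 : cnt A w.+1 = (cnt A w).+1 by rewrite cntS Aw addn1.
have cw0 : 1 <= cnt A w by apply: leq_trans (leq_cnt A w1); rewrite cntS A0.
have cy : cnt (trunc A y) y.+1 = cnt A w.+1 + 1.
  rewrite cnt_trunc cntS Ay; congr (_ + _); rewrite -(subnKC ltwy) cntD.
  rewrite (@cnt0 (fun i => A (w.+1 + i))) ?addn0 // => i lti.
  by apply/negP => /wmax; lia.
have ltyc : cnt A y.+1 <= cnt A L by apply: leq_cnt.
have b1 : 3 * cnt (trunc A y) y.+1 <= cnt (sums (trunc A y) (trunc A y)) (2 * y).+1 + 3.
  apply: IH; rewrite ?cnt_trunc //; first by lia.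
  split; rewrite /trunc ?leqnn //; first by move=> i /andP[].
  by move=> d d1; exists 1; rewrite A1 dvdn1; lia.
have b2 := IH (fun i => A (w + i)) (L - w) ltac:(lia).
have {}b2 : 3 * cnt (fun i => A (w + i)) (L - w).+1 <=
   cnt (sums (fun i => A (w + i)) (fun i => A (w + i))) (2 * (L - w)).+1 + 3.
  apply: b2; last by lia.
  split; rewrite ?addn0 ?subnKC //; try by lia.
    by move=> i /leAL; lia.
  move=> d d1; have [dw|dw] := boolP (d %| L - w).
    exists (L - w).-1; have -> : w + (L - w).-1 = L.-1 by lia.
    rewrite AL1 /=; apply/negP => dw'.
    have := dvdn_sub dw dw'; have -> : L - w - (L - w).-1 = 1 by lia.
    by rewrite dvdn1; lia.
  by exists (L - w); rewrite subnKC ?AL //; lia.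
(* The halves have [|A| + 2] elements together, so [3 (|A| + 2) <= |2A| + 3 + 6]. *)
have := cnt_sums_split_pair leAL ltwy (ltnW ltyL) Aw Ay wmax.
have : cnt (trunc A y) y.+1 = cnt A y.+1 by exact: cnt_trunc.
lia.
Qed.

(** A sparse [A] would violate [freiman_doubling], so [A] is dense and both results on dense sums
    apply with [X = Y = A]. *)
Lemma freiman_3k4 (A : pred nat) (L : nat) : normal A L ->
  cnt (sums A A) (2 * L).+1 + 4 <= 3 * cnt A L.+1 ->
  L + cnt A L.+1 <= cnt (sums A A) (2 * L).+1 /\
  exists u, forall i, i < 2 * cnt A L.+1 - 1 -> sums A A (u + i).
Proof.
move=> nA small; have [A0 AL _ _] := nA.
have dense : L + 3 <= cnt A L.+1 + cnt A L.+1.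
  case: leqP => // lt; have := freiman_doubling nA; lia.
split; first exact: dense_sums_size.
by rewrite mul2n -addnn; apply: dense_long_interval => //; lia.
Qed.

Lemma sumsC (X Y : pred nat) (t : nat) : sums X Y t = sums Y X t.
Proof. by apply/sumsP/sumsP => -[x [y [Xx Yy ->]]]; exists y, x; rewrite addnC. Qed.

End IntegerSets.

(** * Coordinates along progressions modulo a prime, and rectification *)

Section PrimeField.
Variables (p : nat) (pp : prime p).
Implicit Types (b g x : 'F_p) (A B : {set 'F_p}).

Lemma Fp_muln_mod g i : g *+ (i %% p) = g *+ i.
Proof.
rewrite {2}(divn_eq i p) mulrnDr mulnC mulrnA -[g *+ p]mulr_natr.
by rewrite pchar_Fp_0 // mulr0 mul0rn add0r.
Qed.

Lemma Fp_mulnDp g i : g *+ (p + i) = g *+ i.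
Proof. by rewrite -Fp_muln_mod modnDl Fp_muln_mod. Qed.

Lemma Fp_muln_inj g i j : g != 0 -> (i < p)%N -> (j < p)%N -> g *+ i = g *+ j -> i = j.
Proof.
move=> g0 ltip ltjp; rewrite -![g *+ _]mulr_natr => /(mulfI g0) /(congr1 val) /=.
by rewrite !val_Fp_nat // !modn_small.
Qed.

Lemma Fp_coord b g x : g != 0 -> exists2 i, (i < p)%N & x = b + g *+ i.
Proof.
move=> g0; exists (val ((x - b) / g)).
  by have := ltn_ord ((x - b) / g); rewrite [X in (_ < X)%N]Fp_cast.
by rewrite -mulr_natr natr_Zp mulrCA divff // mulr1 addrC subrK.
Qed.

Lemma card_coord b g A : g != 0 -> #|A| = cnt (fun i => b + g *+ i \in A) p.
Proof.
move=> g0; have -> : A = [set b + g *+ i | i : 'I_p in [pred i : 'I_p | b + g *+ i \in A]].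
  apply/setP => x; apply/idP/imsetP => [Ax|[i Ai ->] //].
  by have [i lti xE] := Fp_coord b x g0; exists (Ordinal lti); rewrite ?inE -?xE.
rewrite card_in_imset => [|i j _ _ /addrI eqij]; last first.
  by apply/val_inj/(Fp_muln_inj g0 _ _ eqij).
rewrite cardE /cnt -val_enum_ord count_map -size_filter enumT.
congr (size _); apply: eq_filter => i /=; rewrite inE /=.
by apply/idP/imsetP => [Ai|[j Aj ->] //]; exists i.
Qed.

(** The cutoff [L] selects one representative range, as [i -> b + g *+ i] has period [p]. *)
Definition pull b g A (L : nat) : pred nat := fun i => (i <= L)%N && (b + g *+ i \in A).

Lemma card_pull b g A L : g != 0 -> (L < p)%N ->
  (forall x, x \in A -> exists2 i, (i <= L)%N & x = b + g *+ i) ->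
  #|A| = cnt (pull b g A L) L.+1.
Proof.
move=> g0 ltLp cov; rewrite (card_coord b A g0).
rewrite -(@cnt_ext (pull b g A L) L.+1 p ltLp); last by move=> i /andP[].
apply: eq_cnt => i lti; rewrite /pull; apply/idP/andP => [Ai|[]//]; split=> //.
have [j leL /addrI eqij] := cov _ Ai.
by rewrite (Fp_muln_inj g0 lti _ eqij) // (leq_ltn_trans leL).
Qed.

Lemma sums_pull b g A L i : sums (pull b g A L) (pull b g A L) i ->
  b + b + g *+ i \in sumset A.
Proof.
move=> /sumsP[x [y [/andP[_ Ax] /andP[_ Ay] ->]]].
by rewrite mulrnDr addrACA; apply/imset2P; exists (b + g *+ x) (b + g *+ y).
Qed.

(** As [2L < p], sums of coordinates do not wrap around and distinct ones give distinct residues. *)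
Lemma cnt_sums_pull b g A L : g != 0 -> (2 * L < p)%N ->
  (cnt (sums (pull b g A L) (pull b g A L)) (2 * L).+1 <= #|sumset A|)%N.
Proof.
move=> g0 lt2L; rewrite (card_coord (b + b) _ g0).
by apply: leq_trans (leq_cnt _ lt2L); apply: cnt_sub => i _; apply: sums_pull.
Qed.

(** The progression is cut at the extreme indices [i0], [i1] met by [A], and [g] is replaced by
    [g *+ d] with [d] the gcd of the differences [i - i0]. Then [L <= i1 - i0 < h], whence
    [2L < p]. *)
Lemma normal_form b g A h : g != 0 -> (2 * h <= p.+1)%N ->
  (forall x, x \in A -> exists2 i, (i < h)%N & x = b + g *+ i) -> (1 < #|A|)%N ->
  exists b' g' L, [/\ g' != 0, (2 * L < p)%N, normal (pull b' g' A L) L &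
    forall x, x \in A -> exists2 i, (i <= L)%N & x = b' + g' *+ i].
Proof.
move=> g0 hp cov A2; pose P i := (i < h)%N && (b + g *+ i \in A).
have [x [y [Ax Ay neqxy]]] : exists x y, [/\ x \in A, y \in A & x != y].
  by move/card_gt1P: A2 => [x [y [Ax Ay xy]]]; exists x, y.
have [ix ltix xE] := cov _ Ax; have [iy ltiy yE] := cov _ Ay.
have Pix : P ix by rewrite /P ltix -xE.
have Piy : P iy by rewrite /P ltiy -yE.
have neqi : ix != iy by apply: contraNneq neqxy => eqi; rewrite xE yE eqi.
have exP : exists i, P i by exists ix.
have [i0 Pi0 i0min] := ex_minnP exP.
have ubP i : P i -> (i <= h)%N by case/andP => /ltnW.
have [i1 Pi1 i1max] := ex_maxnP exP ubP.
have lt01 : (i0 < i1)%N.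
  have := i0min _ Pix; have := i0min _ Piy; have := i1max _ Pix; have := i1max _ Piy; lia.
have lti1 : (i1 < h)%N by case/andP: Pi1.
pose D d := all (fun i => P i ==> (d %| i - i0)%N) (iota 0 h).
have DP d : reflect (forall i, P i -> (d %| i - i0)%N) (D d).
  apply: (iffP allP) => [Dd i Pi|Dd i _]; last exact/implyP/Dd.
  by apply: (implyP (Dd i _)); rewrite // mem_iota; case/andP: Pi.
have exD : exists d, D d by exists 1%N; apply/DP => i _; rewrite dvd1n.
have ubD d : D d -> (d <= i1 - i0)%N.
  by move=> /DP /(_ _ Pi1) /dvdn_leq -> //; rewrite subn_gt0.
have [d /DP Dd dmax] := ex_maxnP exD ubD.
have d0 : (0 < d)%N by apply: dmax; apply/DP => i _; rewrite dvd1n.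
have [L dL] : exists L, (d * L = i1 - i0)%N.
  by exists ((i1 - i0) %/ d)%N; rewrite mulnC divnK // Dd.
have led : (d <= i1 - i0)%N by apply: ubD; apply/DP.
exists (b + g *+ i0), (g *+ d), L.
have gE i : b + g *+ i0 + g *+ d *+ i = b + g *+ (i0 + d * i).
  by rewrite -addrA -mulrnA -mulrnDr.
have QP i : pull (b + g *+ i0) (g *+ d) A L i = P (i0 + d * i)%N.
  rewrite /pull gE /P; case Ai: (_ \in A); rewrite ?andbF // !andbT.
  apply/idP/idP => [leL|lth].
    by have := leq_mul (leqnn d) leL; rewrite dL; clear -lti1 lt01; lia.
  have := i1max (i0 + d * i)%N; rewrite /P lth Ai => /(_ isT).
  by move=> le1; rewrite -(leq_pmul2l d0) dL; clear -le1; lia.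
have cov' x' : x' \in A -> exists2 i, (i <= L)%N & x' = b + g *+ i0 + g *+ d *+ i.
  move=> Ax'; have [i lti xE'] := cov _ Ax'.
  have Pi : P i by rewrite /P lti -xE'.
  have di := Dd _ Pi; exists ((i - i0) %/ d)%N.
    by rewrite -(leq_pmul2l d0) mulnC divnK // dL leq_sub2r // i1max.
  by rewrite gE mulnC divnK // subnKC // i0min.
split=> //.
- apply/eqP; rewrite -(mulr0n g) => gd.
  have d_p : (d < p)%N by clear -led lti1 hp; lia.
  by have /eqP := Fp_muln_inj g0 d_p (prime_gt0 pp) gd; rewrite (negbTE (lt0n_neq0 d0)).
- have := leq_pmull L d0; rewrite dL; clear -lti1 hp; lia.
split.
- by rewrite QP muln0 addn0.
- by rewrite QP dL subnKC // ltnW.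
- by move=> i /andP[].
move=> e e1; have nD : ~~ D (d * e)%N.
  by apply/negP => /dmax; rewrite -[leqRHS]muln1 leq_pmul2l // leqNgt e1.
have /allPn[i _] := nD; rewrite negb_imply => /andP[Pi ndi].
exists ((i - i0) %/ d)%N; rewrite QP mulnC divnK ?Dd // subnKC ?i0min // Pi /=.
by apply: contra ndi => de; rewrite -(divnK (Dd _ Pi)) (mulnC _ d) dvdn_pmul2l.
Qed.

Lemma rectified_3k4 b g A h : g != 0 -> (2 * h <= p.+1)%N ->
  (forall x, x \in A -> exists2 i, (i < h)%N & x = b + g *+ i) ->
  (1 < #|A|)%N -> (#|sumset A| + 4 <= 3 * #|A|)%N ->
  exists b' g' L u, [/\ g' != 0, (2 * L < p)%N,
    [/\ pull b' g' A L 0, pull b' g' A L L & (L + #|A| <= #|sumset A|)%N],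
    forall x, x \in A -> exists2 i, (i <= L)%N & x = b' + g' *+ i &
    (u + (2 * #|A| - 1) <= (2 * L).+1)%N /\
    forall i, (i < 2 * #|A| - 1)%N -> b' + b' + g' *+ (u + i) \in sumset A].
Proof.
move=> g0 hp cov A2 small.
have [b' [g' [L [g'0 lt2L nA cov']]]] := normal_form g0 hp cov A2.
have cA := card_pull g'0 (ltac:(lia) : (L < p)%N) cov'.
have cS := cnt_sums_pull b' A g'0 lt2L.
have [le [u Su]] := freiman_3k4 nA (ltac:(lia)).
have [Q0 QL _ _] := nA.
exists b', g', L, u; split=> //; first by split=> //; lia.
rewrite cA; split; last by move=> i /Su /sums_pull.
have leS i : pull b' g' A L i -> (i <= L)%N by case/andP.
have := sums_leq leS leS (Su (2 * cnt (pull b' g' A L) L.+1 - 2)%N ltac:(lia)); lia.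
Qed.

(* [X0] below is the complement of [2A] and [Y] is [-B], both in the coordinates of
   the progression containing [B]; the sum of an element outside [2A] and an
   element of [-B] is never in [A]. *)
Lemma rectify_complement A B b g L u : g != 0 -> (2 * L < p)%N ->
  B \subset A -> B != A ->
  pull b g B L 0 -> pull b g B L L -> (L + #|B| <= #|sumset A|)%N ->
  (forall x, x \in B -> exists2 i, (i <= L)%N & x = b + g *+ i) ->
  (u + (2 * #|B| - 1) <= (2 * L).+1)%N ->
  (forall i, (i < 2 * #|B| - 1)%N -> b + b + g *+ (u + i) \in sumset A) ->
  (#|sumset A| + 4 <= 3 * #|B|)%N -> (4 * #|sumset A| <= 3 * p)%N ->
  exists b' h, (2 * h <= p.+1)%N /\
    forall x, x \in A -> exists2 i, (i < h)%N & x = b' + g *+ i.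
Proof.
move=> g0 lt2L sBA neqBA P0 PL leL cov leu Iu small dens.
set m := #|B| in leL leu Iu small *; set s := #|sumset A| in leL small dens *.
have ltmn : (m < #|A|)%N.
  by rewrite ltn_neqAle subset_leq_card // andbT; apply: contraNneq neqBA => e;
     apply/eqP/setP/subset_cardP.
have [r rE] : exists r, (r + s = p)%N by exists (p - s)%N; clear -dens; lia.
have [l lE] : exists l, l.+1 = (2 * m)%N by exists (2 * m - 1)%N; clear -small; lia.
have [q qE] : exists q, (q + l = p)%N.
  by exists (p - l)%N; clear -lE leu lt2L; lia.
have {}Iu i : (i < l)%N -> b + b + g *+ (u + i) \in sumset A.
  by move=> lti; apply: Iu; rewrite -lE subn1.
(* [c] is the point just after the [l] known terms of the sumset, so the complement has coordinates
   below [q = p - l] from [c]. *)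
pose c : 'F_p := b + b + g *+ (u + l).
pose X0 i := (i < q)%N && (c + g *+ i \notin sumset A).
have cX0 : cnt X0 p = r.
  have -> : cnt X0 p = cnt (predC (fun i => c + g *+ i \in sumset A)) p.
    apply: eq_cnt => i ltip; rewrite /X0 /=; case: ltnP => // lei.
    apply/esym/negbTE; rewrite negbK /c -addrA -mulrnDr.
    have -> : (u + l + i = p + (u + (i - q)))%N by clear -qE lei; lia.
    by rewrite Fp_mulnDp Iu //; clear -qE lei ltip; lia.
  have := cntC (fun i => c + g *+ i \in sumset A) p.
  by rewrite -(card_coord c (sumset A) g0) -/s => e; apply: (@addnI s); rewrite e addnC rE.
have exP : exists i, X0 i.
  case: (altP (@hasP _ X0 (iota 0 p))) => [[i _ Xi]|/hasPn nX]; first by exists i.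
  have := @cnt0 X0 p (fun i lti => nX i ltac:(by rewrite mem_iota)).
  by rewrite cX0 => r0; have := prime_gt0 pp; clear -r0 rE dens; lia.
have [x1 Xx1 x1min] := ex_minnP exP.
have ubP i : X0 i -> (i <= q)%N by case/andP => /ltnW.
have [x2 Xx2 x2max] := ex_maxnP exP ubP.
have le12 := x1min _ Xx2.
have lt2 : (x2 < q)%N by case/andP: Xx2.
have [K KE] : exists K, (x1 + K)%N = x2 by exists (x2 - x1)%N; rewrite subnKC.
pose X i := X0 (x1 + i)%N.
have XK i : X i -> (i <= K)%N by move=> /x2max; rewrite -KE leq_add2l.
have X00 : X 0 by rewrite /X addn0.
have XKK : X K by rewrite /X KE.
have cX : cnt X K.+1 = r.
  rewrite -cX0 (@cnt_ext X0 x2.+1 p).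
  - rewrite -KE -addnS cntD (@cnt0 X0) // => i lti.
    by apply/negP => /x1min; rewrite leqNgt lti.
  - by clear -lt2 qE; lia.
  - by move=> i /x2max; rewrite ltnS.
pose Y := mirror (pull b g B L) L.
have Y0 : Y 0 by rewrite /Y /mirror subn0 PL.
have YL : Y L by rewrite /Y /mirror subnn P0 leqnn.
have YleL i : Y i -> (i <= L)%N by case/andP.
have ltLp : (L < p)%N by clear -lt2L; lia.
have cY : cnt Y L.+1 = m.
  rewrite /m (card_pull g0 ltLp cov) -[RHS]cnt_rev.
  by apply: eq_cnt => i; rewrite ltnS /Y /mirror => ->.
(* With this offset, [d + g *+ (i + j)] is the point of coordinate [i] in the complement minus the
   point of [B] of coordinate [L - j]. *)
pose d : 'F_p := c + g *+ x1 - g *+ L - b.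
have XYd t : sums X Y t -> d + g *+ t \notin A.
  move=> /sumsP[i [j [/andP[_ zS] /andP[jL /andP[_ aB]] ->]]].
  apply: contra zS => Ad; apply/imset2P; exists (b + g *+ (L - j)) (d + g *+ (i + j)) => //.
    exact: (subsetP sBA).
  rewrite /d (mulrnBr _ jL) !mulrnDr.
  by move: (g *+ L) (g *+ j) (g *+ i) (g *+ x1) => y1 y2 y3 y4; ring.
(* No wrap-around: [K <= p - 2m] and [L <= s - m], while [s < 3m]. *)
have ltKL : (K + L < p)%N by clear -KE lt2 qE lE leL small; lia.
set n := #|A| in ltmn.
have cXY k : (cnt (sums X Y) k + n <= p)%N.
  have := cntC (fun i => d + g *+ i \in A) p; rewrite -(card_coord d A g0) -/n => e.
  rewrite -[X in (_ <= X)%N]e addnC leq_add2l; apply: (@leq_trans (cnt (sums X Y) p)); last first.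
    by apply: cnt_sub => i _; apply: XYd.
  case: (leqP k p) => [|/ltnW lek]; first exact: leq_cnt.
  rewrite (@cnt_ext _ p k) // => i /(sums_leq XK YleL) le.
  exact: leq_ltn_trans ltKL.
have rm : (s + 3 <= r + 2 * m /\ 2 * s + 1 <= p + 2 * m)%N by clear -rE dens small; lia.
(* The interval theorem needs the longer set first, hence the two cases. Smallness of the sum uses
   [|A| > m]; the case [K <= L] also uses [4s <= 3p]. *)
have [v Sv] : exists v, forall i, (i < r + m - 1)%N -> sums X Y (v + i).
  case: (leqP L K) => [leLK|/ltnW leKL].
    have cYK : cnt Y K.+1 = m by rewrite -cY; apply: cnt_ext => // i /YleL.
    have := @dense_long_interval X Y K X00 XKK; rewrite cX cYK; apply.
      by clear -KE lt2 qE lE rE small; lia.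
    by have := cXY (2 * K).+1; clear -rE small ltmn; lia.
  have cXL : cnt X L.+1 = r by rewrite -cX; apply: cnt_ext => // i /XK.
  have [] := @dense_long_interval Y X L Y0 YL.
  - by rewrite cXL cY; clear -rE dens small leL; lia.
  - rewrite cXL cY (@eq_cnt _ (sums X Y)) => [|i _]; last exact: sumsC.
    by have := cXY (2 * L).+1; clear -rE dens small ltmn; lia.
  - move=> v Sv; exists v => i lti; rewrite sumsC; apply: Sv.
    by rewrite cXL cY addnC.
(* [A] lies in the [p - (r + m - 1) = s + 1 - m] terms that follow the avoided interval. *)
exists (d + g *+ (v + (r + m - 1))), (s + 1 - m)%N.
split; first by clear -dens small; lia.
move=> x Ax; have [i lti xE] := Fp_coord (d + g *+ (v + (r + m - 1))) x g0.
exists i => //; rewrite ltnNge; apply/negP => lei.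
move: Ax; rewrite xE -addrA -mulrnDr.
have -> : (v + (r + m - 1) + i = p + (v + (i - (s + 1 - m))))%N.
  by clear -lei rE leL small; lia.
by rewrite Fp_mulnDp; apply/negP/XYd/Sv; clear -lei lti rE small leL; lia.
Qed.
End PrimeField.

(** * Fourier analysis modulo [p], written with real functions *)

Section Fourier.
Import reals trigo.
Variables (R : realType) (p : nat) (pp : prime p).
Implicit Types (x y t : 'F_p) (A B : {set 'F_p}).

Let w : R := pi *+ 2 / p%:R.
Let p_gt0 : 0 < p%:R :> R. Proof. by rewrite ltr0n prime_gt0. Qed.
Let p_neq0 : p%:R != 0 :> R. Proof. by rewrite gt_eqF. Qed.

(** [cs] and [sn] are the real and imaginary parts of the additive character [exp(2 pi i x / p)]. *)
Definition cs (x : 'F_p) : R := cos (w * (nat_of_ord x)%:R).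
Definition sn (x : 'F_p) : R := sin (w * (nat_of_ord x)%:R).

Let wD (n : nat) : w * n%:R = w * (n %% p)%:R + pi *+ 2 *+ (n %/ p).
Proof.
rewrite {1}(divn_eq n p) natrD mulrDr addrC; congr (_ + _).
rewrite natrM -[RHS]mulr_natr /w; move: (pi *+ 2) => P.
by rewrite mulrCA mulrC divfK.
Qed.

Lemma cs_nat (n : nat) : cs n%:R = cos (w * n%:R).
Proof. by rewrite wD (periodicn (@cosD2pi R)) /cs val_Fp_nat. Qed.

Lemma sn_nat (n : nat) : sn n%:R = sin (w * n%:R).
Proof. by rewrite wD (periodicn (@sinD2pi R)) /sn val_Fp_nat. Qed.

Lemma csD x y : cs (x + y) = cs x * cs y - sn x * sn y.
Proof.
rewrite -{1}[x]natr_Zp -{1}[y]natr_Zp -natrD cs_nat natrD mulrDr cosD.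
by [].
Qed.

Lemma snD x y : sn (x + y) = sn x * cs y + cs x * sn y.
Proof.
rewrite -{1}[x]natr_Zp -{1}[y]natr_Zp -natrD sn_nat natrD mulrDr sinD.
by [].
Qed.

Lemma cs0 : cs 0 = 1. Proof. by rewrite /cs mulr0 cos0. Qed.
Lemma sn0 : sn 0 = 0. Proof. by rewrite /sn mulr0 sin0. Qed.

Lemma cs2Dsn2 x : cs x ^+ 2 + sn x ^+ 2 = 1.
Proof. exact: cos2Dsin2. Qed.

Lemma csB x y : cs (x - y) = cs x * cs y + sn x * sn y.
Proof.
have := cs2Dsn2 y; have := csD (x - y) y; have := snD (x - y) y; rewrite subrK.
by move=> -> -> e; rewrite -[LHS]mulr1 -e; ring.
Qed.

Lemma snB x y : sn (x - y) = sn x * cs y - cs x * sn y.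
Proof.
have := cs2Dsn2 y; have := csD (x - y) y; have := snD (x - y) y; rewrite subrK.
by move=> -> -> e; rewrite -[LHS]mulr1 -e; ring.
Qed.

Lemma cs1_neq1 : cs 1 != 1.
Proof.
rewrite -[1 : 'F_p]/(1%:R) cs_nat mulr1; apply/negP => /eqP.
rewrite -cos0; have pi0 := @pi_gt0 R.
have p2 : 2 <= p%:R :> R by rewrite ler_nat prime_gt1.
have w0 : 0 < w by rewrite /w divr_gt0 // mulrn_wgt0.
have wpi : w <= pi by rewrite /w ler_pdivrMr // -[pi *+ 2]mulr_natr ler_pM2l.
move=> /cos_inj; rewrite !in_itv /= lexx (ltW w0) wpi (ltW pi0) => /(_ isT isT).
by move/eqP; rewrite gt_eqF.
Qed.

(** Translation by 1 shows that the vector [(C, Z)] is fixed by a rotation other than the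
    identity. *)
Lemma sum_cs0 : \sum_x cs x = 0.
Proof.
set C := \sum_x cs x; set Z := \sum_x sn x.
have eC : C = C * cs 1 - Z * sn 1.
  rewrite {1}/C (reindex_inj (addIr (1 : 'F_p))) /= /C /Z !mulr_suml -sumrB.
  by apply: eq_bigr => x _; rewrite csD.
have eZ : Z = Z * cs 1 + C * sn 1.
  rewrite {1}/Z (reindex_inj (addIr (1 : 'F_p))) /= /C /Z !mulr_suml -big_split /=.
  by apply: eq_bigr => x _; rewrite snD.
have := cs2Dsn2 1; move: eC eZ cs1_neq1; set c := cs 1; set s := sn 1 => eC eZ c1 e1.
have : C * (1 - c) *+ 2 = 0.
  have -> : C * (1 - c) *+ 2 = C * (1 - 2 * c + (c ^+ 2 + s ^+ 2)).
    by rewrite e1 -mulr_natr; ring.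
  have -> : C * (1 - 2 * c + (c ^+ 2 + s ^+ 2)) =
    (C - (C * c - Z * s)) * (1 - c) - s * (Z - (Z * c + C * s)) by ring.
  by rewrite -eC -eZ !subrr mul0r mulr0 subr0.
move/eqP; rewrite mulrn_eq0 /= mulf_eq0 subr_eq0 eq_sym [1 == c]eq_sym (negbTE c1) orbF.
by move/eqP.
Qed.

Lemma sum_cs t : \sum_x cs (t * x) = if t == 0 then p%:R else 0.
Proof.
case: eqP => [->|/eqP t0].
  under eq_bigr do rewrite mul0r cs0.
  by rewrite sumr_const card_Fp.
by rewrite -(reindex_inj (mulfI t0) (P := xpredT) (F := cs)) sum_cs0.
Qed.

(** The squared modulus of the Fourier coefficient of [f] at [t]. *)
Definition energy (f : 'F_p -> R) t : R :=
  (\sum_x f x * cs (t * x)) ^+ 2 + (\sum_x f x * sn (t * x)) ^+ 2.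

Lemma parseval (f : 'F_p -> R) : \sum_t energy f t = p%:R * \sum_x f x ^+ 2.
Proof.
have -> : \sum_t energy f t = \sum_t \sum_x \sum_y f x * f y * cs ((x - y) * t).
  apply: eq_bigr => t _; rewrite /energy !expr2 !mulr_suml -big_split /=.
  apply: eq_bigr => x _; rewrite !mulr_sumr -big_split /=; apply: eq_bigr => y _.
  by rewrite mulrBl csB !(mulrC _ t); ring.
rewrite exchange_big mulr_sumr /=; apply: eq_bigr => x _.
rewrite exchange_big /= (bigD1 x) //= -mulr_sumr sum_cs subrr eqxx big1 ?addr0.
  by rewrite expr2 mulrC.
move=> y neq; rewrite -mulr_sumr sum_cs subr_eq0 eq_sym (negbTE neq).
by rewrite mulr0.
Qed.

Lemma energy_conv (f : 'F_p -> R) t :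
  energy (fun x => \sum_y f y * f (x - y)) t = energy f t ^+ 2.
Proof.
have conv (e : 'F_p -> R) : \sum_x (\sum_y f y * f (x - y)) * e x =
    \sum_y \sum_z f y * f z * e (y + z).
  under eq_bigr do rewrite mulr_suml.
  rewrite exchange_big /=; apply: eq_bigr => y _.
  rewrite (reindex_inj (addrI y)) /=; apply: eq_bigr => z _.
  by rewrite addrAC subrr add0r.
rewrite /energy !conv; set X := \sum_x f x * cs _; set Y := \sum_x f x * sn _.
have -> : \sum_y \sum_z f y * f z * cs (t * (y + z)) = X ^+ 2 - Y ^+ 2.
  rewrite !expr2 /X /Y !mulr_suml -sumrB; apply: eq_bigr => y _.
  rewrite !mulr_sumr -sumrB; apply: eq_bigr => z _.
  by rewrite mulrDr csD; ring.
have -> : \sum_y \sum_z f y * f z * sn (t * (y + z)) = X * Y + Y * X.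
  rewrite /X /Y !mulr_suml -big_split /=; apply: eq_bigr => y _.
  rewrite !mulr_sumr -big_split /=; apply: eq_bigr => z _.
  by rewrite mulrDr snD; ring.
by ring.
Qed.

Definition ind A : 'F_p -> R := fun x => (x \in A)%:R.

Lemma sum_ind A : \sum_x ind A x = #|A|%:R.
Proof.
rewrite -sum1_card natr_sum [RHS]big_mkcond /=.
by apply: eq_bigr => x _; rewrite /ind; case: (x \in A).
Qed.

Lemma energy0 (f : 'F_p -> R) : energy f 0 = (\sum_x f x) ^+ 2.
Proof.
rewrite /energy.
have -> : \sum_x f x * cs (0 * x) = \sum_x f x.
  by apply: eq_bigr => x _; rewrite mul0r cs0 mulr1.
rewrite (@big1 _ _ _ _ _ _ (fun x => f x * sn (0 * x))) ?expr0n ?addr0 // => x _.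
by rewrite mul0r sn0 mulr0.
Qed.

(** Parseval for the representation function [r] gives the fourth moment, Cauchy-Schwarz bounds it
    below, and after removal of the frequency 0 it is at most the largest [E t] times the second
    moment. *)
Lemma large_coefficient A : A != set0 ->
  exists2 t, t != 0 & #|A|%:R ^+ 3 * (p%:R - #|sumset A|%:R) <=
    energy (ind A) t * (#|sumset A|%:R * (p%:R - #|A|%:R)).
Proof.
move=> A0; set n : R := #|A|%:R; set s : R := #|sumset A|%:R; set E := energy (ind A).
have n0 : 0 < n by rewrite /n ltr0n card_gt0.
have s0 : 0 < s.
  have /set0Pn[a Aa] := A0; rewrite /s ltr0n card_gt0; apply/set0Pn; exists (a + a).
  by apply/imset2P; exists a a.
pose r x := \sum_y ind A y * ind A (x - y).
have rS x : x \notin sumset A -> r x = 0.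
  move=> xS; apply: big1 => y _; rewrite /ind -natrM mulnb.
  case: andP => // -[Ay Axy]; case/negP: xS; apply/imset2P.
  by exists y (x - y) => //; rewrite addrC subrK.
have sumr : \sum_x r x = n ^+ 2.
  rewrite /r exchange_big /= expr2 /n -sum_ind mulr_suml; apply: eq_bigr => y _.
  rewrite -mulr_sumr (reindex_inj (addrI y)) /=; congr (_ * _); apply: eq_bigr => z _.
  by rewrite addrAC subrr add0r.
have CS : n ^+ 4 <= s * \sum_x r x ^+ 2.
  have sumrS : \sum_(x in sumset A) r x = n ^+ 2.
    by rewrite -sumr [LHS]big_mkcond; apply: eq_bigr => x _; case: ifPn => // /rS.
  have sumr2S : \sum_(x in sumset A) r x ^+ 2 = \sum_x r x ^+ 2.
    rewrite [LHS]big_mkcond; apply: eq_bigr => x _; case: ifPn => // /rS ->.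
    by rewrite expr0n.
  (* Cauchy-Schwarz as a variance: [n ^+ 2 / s] is the mean of [r] over the sumset. *)
  have : 0 <= \sum_(x in sumset A) (s * r x - n ^+ 2) ^+ 2.
    by apply: sumr_ge0 => x _; exact: sqr_ge0.
  have -> : \sum_(x in sumset A) (s * r x - n ^+ 2) ^+ 2 =
      \sum_(x in sumset A) (s ^+ 2 * r x ^+ 2 + (- (2 * s * n ^+ 2)) * r x + n ^+ 4).
    by apply: eq_bigr => x _; ring.
  rewrite !big_split /= sumr_const -!mulr_sumr sumrS sumr2S -[n ^+ 4 *+ _]mulr_natl -/s.
  have -> : s ^+ 2 * (\sum_x r x ^+ 2) + - (2 * s * n ^+ 2) * n ^+ 2 + s * n ^+ 4 =
     s * (s * (\sum_x r x ^+ 2) - n ^+ 4) by ring.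
  by rewrite pmulr_rge0 // subr_ge0.
have E0 : E 0 = n ^+ 2 by rewrite /E energy0 sum_ind.
have sumE : \sum_(t | t != 0) E t = n * (p%:R - n).
  have := parseval (ind A); rewrite (bigD1 0) //= -/E E0.
  have -> : \sum_x ind A x ^+ 2 = n.
    by rewrite /n -sum_ind; apply: eq_bigr => x _; rewrite /ind expr2 -natrM mulnb andbb.
  by move=> e; rewrite -[LHS](addKr (n ^+ 2)) e; ring.
have sumE2 : \sum_(t | t != 0) E t ^+ 2 = p%:R * (\sum_x r x ^+ 2) - n ^+ 4.
  have := parseval r; rewrite (bigD1 0) //= {1}/r energy_conv -/E E0.
  under eq_bigr do rewrite energy_conv -/E.
  by move=> <-; ring.
case: (@Order.TotalTheory.arg_maxP _ _ _ (1 : 'F_p) (fun t => t != 0) E (oner_neq0 _)) => t t0 tmax.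
exists t => //; rewrite -/E.
have : \sum_(t | t != 0) E t ^+ 2 <= E t * (n * (p%:R - n)).
  rewrite -sumE mulr_sumr; apply: ler_sum => x x0; rewrite expr2.
  by apply: ler_wpM2r; [rewrite addr_ge0 ?sqr_ge0 | exact: tmax].
rewrite sumE2 => le1.
rewrite -(ler_pM2l n0).
have : n ^+ 4 * p%:R <= s * (p%:R * \sum_x r x ^+ 2).
  by rewrite mulrCA [leLHS]mulrC ler_wpM2l // ltW.
have := ler_wpM2l (ltW s0) le1.
set Q := \sum_x r x ^+ 2; move=> h1 h2.
have -> : n * (n ^+ 3 * (p%:R - s)) = n ^+ 4 * p%:R - s * n ^+ 4 by ring.
have -> : n * (E t * (s * (p%:R - n))) = s * (E t * (n * (p%:R - n))) by ring.
by move: h1; rewrite mulrBr; lra.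
Qed.
End Fourier.

(** * Half-circles and the Fourier coefficient at frequency 1 *)

Definition arc_set (p : nat) (B : {set 'F_p}) (b : 'F_p) (h : nat) : {set 'F_p} :=
  [set x in B | (nat_of_ord (x - b)%R < h)%N].

Section HalfCircle.
Import reals trigo.
Variables (R : realType) (p : nat) (pp : prime p) (podd : odd p).
Implicit Types (x y t j : 'F_p) (A B : {set 'F_p}).

Let u : R := pi / p%:R.
Let p_gt0 : 0 < p%:R :> R. Proof. by rewrite ltr0n prime_gt0. Qed.
Let p_neq0 : p%:R != 0 :> R. Proof. by rewrite gt_eqF. Qed.
Let u_gt0 : 0 < u. Proof. by rewrite divr_gt0 ?pi_gt0. Qed.
Let piE : pi = u * p%:R. Proof. by rewrite /u divfK. Qed.
Let wE : pi *+ 2 / p%:R = 2 * u :> R. Proof. by rewrite /u -[pi *+ 2]mulr_natl mulrA. Qed.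

Let f := (p %/ 4)%N.
(** [eps] is the sign of [cs]: it is 1 exactly at the residues from [-f] to [f]. *)
Let eps x : R := if (nat_of_ord (x + f%:R)%R < (2 * f).+1)%N then 1 else -1.
Let K := \sum_x eps x * cs R x.
Let K' := \sum_x eps x * sn R x.
Let S (phi : R) := \sum_(x : 'F_p) `|cos phi * cs R x - sin phi * sn R x|.

Let Fp_val_lt x : (nat_of_ord x < p)%N.
Proof. by have := ltn_ord x; rewrite [X in (_ < X)%N]Fp_cast. Qed.

Let f_bounds : ((4 * f).+1 <= p <= (4 * f) + 3)%N.
Proof.
have := divn_eq p 4; rewrite -/f => e; have lt4 := ltn_pmod p (isT : (0 < 4)%N).
have : (p %% 4 != 0)%N.
  apply: contraTneq podd => e0; rewrite e e0 addn0 oddM /= andbF.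
  by [].
lia.
Qed.

(** Translating [x] by [(p + 1) / 2] adds the angle [u + pi], and the absolute value hides the
    [pi]. *)
Let S_period (phi : R) : S (phi + u) = S phi.
Proof.
rewrite [RHS]/S (reindex_inj (addIr ((p.+1)./2%:R : 'F_p))) /=.
apply: eq_bigr => x _; rewrite csD // snD // cs_nat // sn_nat // wE.
have -> : 2 * u * (p.+1)./2%:R = u + pi.
  have e : 2 * (p.+1)./2%:R = p%:R + 1 :> R.
    rewrite natr1 -natrM mul2n; congr _%:R.
    by have := odd_double_half p.+1; rewrite /= podd.
  by rewrite mulrAC e piE; ring.
rewrite (cosDpi u) (sinDpi u) cosD sinD -[LHS]normrN; congr `| _ |.
by ring.
Qed.

Let S_periodn (phi : R) n : S (phi + u *+ n) = S phi.
Proof. by elim: n phi => [|n IHn] phi; rewrite ?mulr0n ?addr0 // mulrS addrA IHn S_period. Qed.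

Let coord x : cs R x = cos (2 * u * ((nat_of_ord (x + f%:R)%R)%:R - f%:R)) /\
              sn R x = sin (2 * u * ((nat_of_ord (x + f%:R)%R)%:R - f%:R)).
Proof.
have e : x = (nat_of_ord (x + f%:R)%R)%:R - f%:R by rewrite natr_Zp addrK.
split; rewrite [in LHS]e.
  by rewrite csB // !cs_nat // !sn_nat // wE mulrBr cosB.
by rewrite snB // !cs_nat // !sn_nat // wE mulrBr sinB.
Qed.

(** A rotation by at most [u / 2] leaves every cosine weakly of the sign [eps x]. *)
Let S_small (psi : R) : - (u / 2) <= psi <= u / 2 -> S psi = K * cos psi - K' * sin psi.
Proof.
move=> /andP[psi1 psi2]; rewrite /S /K /K' !mulr_suml -sumrB; apply: eq_bigr => x _.
have [-> ->] := coord x; rewrite /eps; set i := nat_of_ord (x + f%:R)%R.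
set v := 2 * u * _; have -> : cos psi * cos v - sin psi * sin v = cos (psi + v) by rewrite cosD.
have [/andP[fb1 fb2] ip] := (f_bounds, Fp_val_lt (x + f%:R)); rewrite -/i in ip.
have F1 : 4 * (u * f%:R) + u <= u * p%:R.
  have -> : 4 * (u * f%:R) + u = u * (4 * f).+1%:R by rewrite -[(4 * f).+1%:R]natr1 natrM; ring.
  by rewrite ler_pM2l // ler_nat.
have F2 : u * p%:R <= 4 * (u * f%:R) + 3 * u.
  have -> : 4 * (u * f%:R) + 3 * u = u * (4 * f + 3)%:R by rewrite natrD natrM; ring.
  by rewrite ler_pM2l // ler_nat.
have F3 : u * i%:R + u <= u * p%:R.
  have -> : u * i%:R + u = u * i.+1%:R by rewrite -[i.+1%:R]natr1; ring.
  by rewrite ler_pM2l // ler_nat.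
have F4 : 0 <= u * i%:R by rewrite mulr_ge0 // ltW.
have vE : v = 2 * (u * i%:R) - 2 * (u * f%:R) by rewrite /v; ring.
have u0 := u_gt0.
case: ltnP => hi.
  have F5 : u * i%:R <= 2 * (u * f%:R).
    have -> : 2 * (u * f%:R) = u * (2 * f)%:R by rewrite natrM; ring.
    by rewrite ler_pM2l // ler_nat -ltnS.
  rewrite !mul1r ger0_norm ?cosD; first by ring.
  rewrite -cosD; apply: cos_ge0_pihalf; rewrite piE vE; apply/andP; split; lra.
have F5 : 2 * (u * f%:R) + u <= u * i%:R.
  have -> : 2 * (u * f%:R) + u = u * (2 * f).+1%:R by rewrite -[(2 * f).+1%:R]natr1 natrM; ring.
  by rewrite ler_pM2l // ler_nat.
rewrite ler0_norm ?cosD; first by ring.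
rewrite -cosD -[psi + v](subrK pi) cosDpi oppr_le0.
apply: cos_ge0_pihalf; rewrite piE vE; apply/andP; split; lra.
Qed.

Let S_ge0 (phi : R) : 0 <= S phi. Proof. by apply: sumr_ge0 => x _. Qed.

(** Rounding [phi] to a multiple of the period [u] reduces to [S_small], then Cauchy-Schwarz
    applies; [phi >= 0] lets [truncn] do the rounding. *)
Let S_le (phi : R) : 0 <= phi -> S phi ^+ 2 <= K ^+ 2 + K' ^+ 2.
Proof.
move=> phi0; pose z := Num.truncn (phi / u + 1 / 2); pose psi := phi - u *+ z.
have -> : S phi = S psi by rewrite -[RHS](S_periodn _ z) /psi subrK.
have z0 : 0 <= phi / u + 1 / 2 by apply: addr_ge0; [exact: divr_ge0 phi0 (ltW u_gt0)|lra].
have /andP[z1 z2] := truncn_itv z0.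
have u0 := u_gt0.
have {z1} z1 : u * z%:R <= phi + u / 2.
  by rewrite -ler_pdivlMl // mulrDr mulrC (mulrC _ (u / 2)) mulrAC divff ?gt_eqF.
have {z2} z2 : phi + u / 2 <= u * z%:R + u.
  rewrite -[leRHS](_ : u * z.+1%:R = _); last by rewrite -[z.+1%:R]natr1; ring.
  rewrite -ler_pdivrMl // mulrDr mulrC (mulrC _ (u / 2)) mulrAC divff ?gt_eqF //.
  exact: ltW.
have pE : psi = phi - u * z%:R by rewrite /psi mulr_natr.
rewrite S_small; last by apply/andP; split; lra.
have -> : K ^+ 2 + K' ^+ 2 = (K ^+ 2 + K' ^+ 2) * (cos psi ^+ 2 + sin psi ^+ 2).
  by rewrite cos2Dsin2 mulr1.
rewrite -subr_ge0; apply: le_trans (sqr_ge0 (K * sin psi + K' * cos psi)) _.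
by rewrite le_eqVlt; apply/orP; left; apply/eqP; ring.
Qed.

Let K_gt0 : 0 < K ^+ 2 + K' ^+ 2.
Proof.
apply: lt_le_trans (S_le (lexx 0)); rewrite exprn_gt0 //.
rewrite /S (bigD1 0) //= cos0 sin0 mul0r subr0 mul1r cs0 normr1.
by rewrite ltr_wpDr // sumr_ge0.
Qed.

Let polar (a b : R) : exists phi, [/\ 0 <= phi, a = Num.sqrt (a ^+ 2 + b ^+ 2) * cos phi &
   b = - (Num.sqrt (a ^+ 2 + b ^+ 2) * sin phi)].
Proof.
set rho := Num.sqrt _; have rho2 : rho ^+ 2 = a ^+ 2 + b ^+ 2.
  by rewrite sqr_sqrtr // addr_ge0 ?sqr_ge0.
case: (eqVneq rho 0) => [r0|r0].
  have a2 := sqr_ge0 a; have b2 := sqr_ge0 b; move: rho2; rewrite r0 expr0n /= => ab0.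
  exists 0; rewrite !mul0r oppr0; split=> //.
    by apply/eqP; rewrite -sqrf_eq0; apply/eqP; lra.
  by apply/eqP; rewrite -sqrf_eq0; apply/eqP; lra.
have rp : 0 < rho by rewrite lt_neqAle eq_sym r0 sqrtr_ge0.
have ab : `|a| <= rho.
  have : `|a| ^+ 2 <= rho ^+ 2 by rewrite rho2 real_normK ?num_real // lerDl sqr_ge0.
  by rewrite ler_sqr ?nnegrE // ltW.
have ra : -1 <= a / rho <= 1.
  by rewrite -ler_norml normrM normfV (gtr0_norm rp) ler_pdivrMr // mul1r.
have cE : cos (acos (a / rho)) = a / rho by rewrite acosK // in_itv.
have sE : sin (acos (a / rho)) = `|b| / rho.
  rewrite sin_acos //; have -> : 1 - (a / rho) ^+ 2 = (b / rho) ^+ 2.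
    rewrite !expr_div_n rho2 -[X in X - _](divff (x := a ^+ 2 + b ^+ 2)).
      by rewrite -mulrBl addrAC subrr add0r.
    by rewrite -rho2 sqrf_eq0.
  by rewrite sqrtr_sqr normrM normfV (gtr0_norm rp).
case: (leP b 0) => b0.
  exists (acos (a / rho)); split; first exact: acos_ge0.
    by rewrite cE mulrC divfK.
  by rewrite sE ler0_norm // mulrC divfK // opprK.
exists (pi *+ 2 - acos (a / rho)); split.
- by rewrite subr_ge0 (le_trans (acos_lepi ra)) // mulr2n lerDl pi_ge0.
- by rewrite addrC cosD2pi cosN cE mulrC divfK.
- by rewrite addrC sinD2pi sinN sE gtr0_norm // mulrN opprK mulrC divfK.
Qed.

Variables (B : {set 'F_p}) (m : nat).
Hypothesis arc_le : forall b h, (2 * h <= p.+1)%N -> (#|arc_set B b h| <= m)%N.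

Let c j := \sum_x ind R B x * eps (x - j).
Let W : R := 2 * m%:R - #|B|%:R.

Let c_le j : `|c j| <= W.
Proof.
pose C x := (nat_of_ord (x - j + f%:R)%R < (2 * f).+1)%N.
have cE : c j = #|[set x in B | C x]|%:R - #|[set x in B | ~~ C x]|%:R.
  rewrite -!(sum_ind R) -sumrB; apply: eq_bigr => x _.
  rewrite /ind !inE /eps -/(C x); case: (x \in B) => /=; last by rewrite mul0r subrr.
  by rewrite mul1r; case: (C x); rewrite /= ?subr0 ?sub0r.
have NE : (#|[set x in B | C x]| + #|[set x in B | ~~ C x]| = #|B|)%N.
  rewrite -(cardsID [set x | C x] B); congr (_ + _)%N; apply: eq_card => x.
    by rewrite !inE.
  by rewrite !inE andbC.
(* The bounds on [f] make both half-circles, of [2f + 1] and [p - 2f - 1] terms, admissible in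
   [arc_le]. *)
have [/andP[fb1 fb2]] := f_bounds.
have N1 : (#|[set x in B | C x]| <= m)%N.
  have := arc_le (j - f%:R) (ltac:(lia) : (2 * (2 * f).+1 <= p.+1)%N).
  apply: leq_trans; apply: subset_leq_card; apply/subsetP => x.
  by rewrite !inE /C opprB addrA addrAC.
have N2 : (#|[set x in B | ~~ C x]| <= m)%N.
  have := arc_le (j - f%:R + (2 * f).+1%:R) (ltac:(lia) : (2 * (p - (2 * f).+1) <= p.+1)%N).
  apply: leq_trans; apply: subset_leq_card; apply/subsetP => x.
  rewrite !inE /C -leqNgt => /andP[->]; rewrite andTb; set y : 'F_p := x - j + f%:R => le.
  have -> : x - (j - f%:R + (2 * f).+1%:R) = (nat_of_ord y - (2 * f).+1)%N%:R.
    by rewrite natrB // natr_Zp /y; ring.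
  have yp := Fp_val_lt y; rewrite val_Fp_nat // modn_small; lia.
have {}NE : #|[set x in B | C x]|%:R + #|[set x in B | ~~ C x]|%:R = #|B|%:R :> R.
  by rewrite -natrD NE.
rewrite -(ler_nat R) in N1; rewrite -(ler_nat R) in N2.
by rewrite cE ler_norml /W; apply/andP; split; lra.
Qed.

(* [c j] compares the two half-circles cut at [j], so [|c j| <= W]; the transform of
   [c] at frequency 1 is that of [B] times the transform [(K, K')] of [eps], and
   [S], which has period [pi / p], is at most the modulus of [(K, K')]. *)
Lemma half_circle : energy (ind R B) 1 <= W ^+ 2 /\ 0 <= W.
Proof.
have W0 : 0 <= W by apply: le_trans (c_le 0).
split=> //; set X := \sum_x ind R B x * cs R x; set Y := \sum_x ind R B x * sn R x.
have EE : energy (ind R B) 1 = X ^+ 2 + Y ^+ 2.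
  rewrite /energy; congr (_ ^+ 2 + _ ^+ 2); apply: eq_bigr => x _; by rewrite mul1r.
pose P1 := \sum_j c j * cs R j; pose P2 := \sum_j c j * sn R j.
have conv (e : 'F_p -> R) : \sum_j c j * e j = \sum_x \sum_k ind R B x * eps k * e (x - k).
  under eq_bigr do rewrite mulr_suml.
  rewrite exchange_big /=; apply: eq_bigr => x _.
  rewrite (reindex_inj (inj_comp (addrI x) oppr_inj)) /=; apply: eq_bigr => k _.
  by rewrite opprB addrC subrK.
have P1E : P1 = X * K + Y * K'.
  rewrite /P1 conv /X /Y !mulr_suml -big_split /=; apply: eq_bigr => x _.
  rewrite /K /K' !mulr_sumr -big_split /=; apply: eq_bigr => k _.
  by rewrite csB //; ring.
have P2E : P2 = Y * K - X * K'.
  rewrite /P2 conv /X /Y !mulr_suml -sumrB; apply: eq_bigr => x _.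
  rewrite /K /K' !mulr_sumr -sumrB; apply: eq_bigr => k _.
  by rewrite snB //; ring.
have [phi [phi0 P1p P2p]] := polar P1 P2.
set rho := Num.sqrt _ in P1p P2p.
have rho2 : rho ^+ 2 = P1 ^+ 2 + P2 ^+ 2 by rewrite sqr_sqrtr // addr_ge0 ?sqr_ge0.
have rho0 : 0 <= rho by rewrite sqrtr_ge0.
have le1 : rho <= W * S phi.
  (* Rotating by [phi] aligns the transform of [c] with the real axis, so its modulus is a single
     real sum. *)
  have -> : rho = \sum_j c j * (cos phi * cs R j - sin phi * sn R j).
    have -> : \sum_j c j * (cos phi * cs R j - sin phi * sn R j) =
        P1 * cos phi - P2 * sin phi.
      rewrite /P1 /P2 !mulr_suml -sumrB; apply: eq_bigr => j _; ring.
    rewrite P1p P2p -[LHS]mulr1 -(cos2Dsin2 phi); ring.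
  apply: le_trans (ler_norm _) _; apply: le_trans (ler_norm_sum _ _ _) _.
  rewrite /S mulr_sumr; apply: ler_sum => j _; rewrite normrM ler_wpM2r //.
rewrite EE -(ler_pM2r K_gt0).
have -> : (X ^+ 2 + Y ^+ 2) * (K ^+ 2 + K' ^+ 2) = rho ^+ 2.
  by rewrite rho2 P1E P2E; ring.
apply: (@le_trans _ _ ((W * S phi) ^+ 2)).
  by rewrite ler_sqr ?nnegrE // mulr_ge0.
by rewrite exprMn ler_wpM2l ?sqr_ge0 // S_le.
Qed.
End HalfCircle.

(** * Concentration of [A] on a short progression, and the role of the cubic *)

Lemma card_sumset_ge (p : nat) (A : {set 'F_p}) : A != set0 -> (#|A| <= #|sumset A|)%N.
Proof.
move=> /set0Pn[a Aa]; rewrite -(card_imset A (addrI a)).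
apply: subset_leq_card; apply/subsetP => _ /imsetP[x Ax ->].
by apply/imset2P; exists a x.
Qed.

Lemma sumset_subset (p : nat) (A B : {set 'F_p}) :
  B \subset A -> sumset B \subset sumset A.
Proof.
move=> /subsetP sBA; apply/subsetP => _ /imset2P[x y Bx By ->].
by apply/imset2P; exists x y => //; exact: sBA.
Qed.

Section Concentration.
Import Rstruct reals.

(** Dilation by [t] moves the large coefficient to frequency 1, where [half_circle] bounds it
    through the richest arc. The conclusion is in [nat], so the reals used here need not be the
    field of the theorem. *)
Lemma concentrated_subset (p : nat) (A : {set 'F_p}) : prime p -> odd p -> A != set0 ->
  exists (B : {set 'F_p}) (g b : 'F_p) (h : nat), [/\ B \subset A, g != 0, (2 * h <= p.+1)%N,
    forall x, x \in B -> exists2 i, (i < h)%N & x = b + g *+ i &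
    (#|A| <= 2 * #|B|)%N /\
    (#|A| ^ 3 * (p - #|sumset A|) <=
       (2 * #|B| - #|A|) ^ 2 * (#|sumset A| * (p - #|A|)))%N].
Proof.
move=> pp podd A0; pose R : realType := Rdefinitions.R.
have p2 := prime_gt1 pp.
have [t t0 tE] := @large_coefficient R p pp A A0.
pose B0 : {set 'F_p} := [set x | t^-1 * x \in A].
have B0E : B0 = [set t * x | x in A].
  apply/setP => x; rewrite inE; apply/idP/imsetP => [Ax|[y Ay ->]].
    by exists (t^-1 * x) => //; rewrite mulVKf.
  by rewrite mulKf.
have cB0 : #|B0| = #|A| by rewrite B0E card_imset //; exact: mulfI.
have EE : energy (ind R A) t = energy (ind R B0) 1.
  have ee (e : 'F_p -> R) : \sum_x ind R A x * e (t * x) = \sum_x ind R B0 x * e (1 * x).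
    rewrite [RHS](reindex_inj (mulfI t0)); apply: eq_bigr => x _.
    by rewrite mul1r /ind inE mulKf.
  by rewrite /energy !ee.
pose P (bh : 'F_p * 'I_p.+1) := (2 * bh.2 <= p.+1)%N.
have P0 : P (0, ord0) by rewrite /P muln0.
case: (arg_maxnP (fun bh : 'F_p * 'I_p.+1 => #|arc_set B0 bh.1 bh.2|) P0) => -[b h] /= Ph hmax.
set m := #|arc_set B0 b h| in hmax *.
have arc_le b' h' : (2 * h' <= p.+1)%N -> (#|arc_set B0 b' h'| <= m)%N.
  move=> h'p; have lth' : (h' < p.+1)%N by lia.
  exact: (hmax (b', Ordinal lth') h'p).
have [hc W0] := half_circle R pp podd arc_le.
pose B : {set 'F_p} := [set x in A | t * x \in arc_set B0 b h].
have cB : #|B| = m.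
  rewrite /m -(card_imset B (mulfI t0)); apply: eq_card => x; apply/imsetP/idP.
    by move=> [y]; rewrite inE => /andP[_ ty] ->.
  move=> xa; exists (t^-1 * x); rewrite ?mulVKf // inE mulVKf // xa andbT.
  by move: xa; rewrite !inE => /andP[].
have mn : (#|A| <= 2 * m)%N.
  by move: W0; rewrite subr_ge0 -natrM ler_nat cB0.
exists B, t^-1, (t^-1 * b), h; split=> //.
- by apply/subsetP => x; rewrite inE => /andP[].
- by rewrite invr_eq0.
- move=> x; rewrite inE => /andP[_]; rewrite inE => /andP[_ lth].
  exists (nat_of_ord (t * x - b)) => //.
  by rewrite -mulr_natr natr_Zp -mulrDr addrC subrK mulKf.
rewrite cB; split=> //; rewrite -(ler_nat R).
have sp : (#|sumset A| <= p)%N by rewrite -[leqRHS](card_Fp pp) max_card.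
have np : (#|A| <= p)%N by rewrite -[leqRHS](card_Fp pp) max_card.
rewrite [in leLHS]natrM [in leRHS]natrM [(#|sumset A| * _)%:R]natrM !natrX !natrB // [(2 * m)%:R]natrM; apply: le_trans tE _.
rewrite EE -cB0; apply: ler_wpM2r hc.
by rewrite mulr_ge0 // subr_ge0 ler_nat cB0.
Qed.

End Concentration.

(* The cubic says [(1 + 2 alpha)^2 (2 + alpha - eps) = 9 (1 - eps)]. *)
Lemma cubic_threshold (R : rcfType) (eps alpha n s p m : R) :
  0 < eps -> eps <= 3 / 4 -> 0 < alpha -> cubic eps alpha = 0 ->
  0 < n -> n <= s -> s < p -> s <= eps * p -> s <= (2 + alpha) * n - 3 ->
  n <= 2 * m -> n ^+ 3 * (p - s) <= (2 * m - n) ^+ 2 * (s * (p - n)) ->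
  s + 3 < 3 * m.
Proof.
move=> e0 e1 a0 ca n0 lens ltsp les le2 lenm fourier; rewrite ltNge; apply/negP => lem.
have ca' : (1 + 2 * alpha) ^+ 2 * (2 + alpha - eps) = 9 * (1 - eps).
  by rewrite -[RHS]addr0 -ca /cubic; ring.
(* The negated goal gives [3m <= s + 3 <= (2 + alpha) n]. *)
have h1 : (3 * (2 * m - n)) ^+ 2 <= ((1 + 2 * alpha) * n) ^+ 2.
  by rewrite ler_sqr ?nnegrE; [lra|lra|apply: mulr_ge0; lra].
have spn : 0 <= s * (p - n) by apply: mulr_ge0; lra.
have h2 : 9 * (n * (p - s)) <= (1 + 2 * alpha) ^+ 2 * (s * (p - n)).
  have n2 : 0 < n ^+ 2 by rewrite exprn_gt0.
  rewrite -(ler_pM2l n2).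
  have -> : n ^+ 2 * (9 * (n * (p - s))) = 9 * (n ^+ 3 * (p - s)) by ring.
  have -> : n ^+ 2 * ((1 + 2 * alpha) ^+ 2 * (s * (p - n))) =
            ((1 + 2 * alpha) * n) ^+ 2 * (s * (p - n)) by ring.
  apply: (@le_trans _ _ ((3 * (2 * m - n)) ^+ 2 * (s * (p - n)))); last exact: ler_wpM2r.
  have -> : (3 * (2 * m - n)) ^+ 2 * (s * (p - n)) =
            9 * ((2 * m - n) ^+ 2 * (s * (p - n))) by ring.
  by rewrite ler_pM2l.
have q0 : 0 < 2 + alpha - eps by lra.
have h3 : 9 * (n * (p - s)) * (2 + alpha - eps) <= 9 * (1 - eps) * (s * (p - n)).
  have -> : 9 * (1 - eps) * (s * (p - n)) =
    (1 + 2 * alpha) ^+ 2 * (s * (p - n)) * (2 + alpha - eps) by rewrite -ca'; ring.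
  by rewrite ler_pM2r.
have h4 : s * (p - s) < (2 + alpha) * n * (p - s) by rewrite ltr_pM2r; lra.
have h5 : 0 <= (eps * p - s) * (s - n) by apply: mulr_ge0; lra.
(* [h3] makes the left side at most 0, whereas [h4] and [h5] make the right side positive. *)
have e : n * (p - s) * (2 + alpha - eps) - (1 - eps) * (s * (p - n)) =
   ((2 + alpha) * n * (p - s) - s * (p - s)) + (eps * p - s) * (s - n) by ring.
by lra.
Qed.

(** * Rectification of [A] and extraction of the two progressions *)

Theorem theorem2p1 (R : rcfType) (p : nat) (pp : prime p) (eps alpha : R)
  (heps0 : 0 < eps) (heps1 : eps <= 3 / 4)
  (halpha_pos : 0 < alpha) (halpha_root : cubic eps alpha = 0)
  (halpha_uniq : forall x : R, 0 < x -> cubic eps x = 0 -> x = alpha)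
  (A : {set 'F_p}) (hA : A != set0)
  (h1 : (#|sumset A|%:R : R) <= (2 + alpha) * #|A|%:R - 3)
  (h2 : (#|sumset A|%:R : R) <= eps * p%:R) :
  let r : int := (#|sumset A|%:Z - 2 * #|A|%:Z) in
  exists (PA P2A : {set 'F_p}) (g : 'F_p),
    is_AP PA g /\ is_AP P2A g /\
    A \subset PA /\ (#|PA|%:Z <= #|A|%:Z + r + 1) /\
    P2A \subset sumset A /\ (2 * #|A|%:Z - 1 <= #|P2A|%:Z).
Proof.
move=> r; have p0 := prime_gt0 pp; have p0R : 0 < p%:R :> R by rewrite ltr0n.
have n0 : (0 < #|A|)%N by rewrite card_gt0.
have les := card_sumset_ge hA.
have dens : (4 * #|sumset A| <= 3 * p)%N.
  rewrite -(ler_nat R) !natrM; have := ler_wpM2r (ltW p0R) heps1; lra.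
have n2 : (1 < #|A|)%N.
  (* If [|A| = 1], then [h1] forces [alpha >= 1], where the cubic is at least 18. *)
  rewrite ltn_neqAle n0 andbT; apply/eqP => n1; move: h1; rewrite -n1 => h1.
  have s0 : 0 <= #|sumset A|%:R :> R by [].
  have a1 : 1 <= alpha by lra.
  have a2 : 1 <= alpha ^+ 2 by rewrite exprn_ege1.
  have a3 : 1 <= alpha ^+ 3 by rewrite exprn_ege1.
  have b2 := ler_wpM2l (ltac:(lra) : 0 <= 12 - 4 * eps) a2.
  have b1 := ler_wpM2l (ltac:(lra) : 0 <= 9 - 4 * eps) a1.
  by move: halpha_root; rewrite /cubic; lra.
have podd : odd p.
  by case: (even_prime pp) => // p2; exfalso; clear -dens les n2 p2; lia.
have [B [g [b [h [sBA g0 hp cov [lenB fourier]]]]]] := concentrated_subset pp podd hA.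
have small : (#|sumset A| + 4 <= 3 * #|B|)%N.
  have sp : (#|sumset A| < p)%N by clear -dens p0; lia.
  have np : (#|A| <= p)%N by exact: leq_trans les (ltnW sp).
  suff lt : (#|sumset A| + 3 < 3 * #|B|)%N by clear -lt; lia.
  rewrite -(ltr_nat R) natrD natrM.
  apply: (cubic_threshold (n := #|A|%:R) (p := p%:R) heps0 heps1 halpha_pos halpha_root) => //.
  - by rewrite ltr0n.
  - by rewrite ler_nat.
  - by rewrite ltr_nat.
  - by rewrite -natrM ler_nat.
  have -> : #|A|%:R ^+ 3 * (p%:R - #|sumset A|%:R) =
      (#|A| ^ 3 * (p - #|sumset A|))%:R :> R by rewrite natrM natrX natrB // ltnW.
  have -> : (2 * #|B|%:R - #|A|%:R) ^+ 2 * (#|sumset A|%:R * (p%:R - #|A|%:R)) =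
      ((2 * #|B| - #|A|) ^ 2 * (#|sumset A| * (p - #|A|)))%:R :> R.
    by rewrite natrM [(#|sumset A| * _)%:R]natrM natrX !natrB // natrM.
  by rewrite ler_nat.
have B2 : (1 < #|B|)%N by clear -lenB n2 small les; lia.
have sSS := sumset_subset sBA; have leSS := subset_leq_card sSS.
(* Either [B] is already [A], or the duality argument carries the short progression from [B] to
   [A]. *)
have [b1 [g1 [h1' [g10 hp1 cov1]]]] : exists b1 g1 h1', [/\ g1 != 0, (2 * h1' <= p.+1)%N &
    forall x, x \in A -> exists2 i, (i < h1')%N & x = b1 + g1 *+ i].
  have [eBA|neBA] := eqVneq B A; first by exists b, g, h; split; rewrite // -eBA.
  have smallB : (#|sumset B| + 4 <= 3 * #|B|)%N by clear -leSS small; lia.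
  have [b' [g' [L [u [g'0 lt2L [P0 PL leL] cov' [leu Iu]]]]]] :=
    rectified_3k4 pp g0 hp cov B2 smallB.
  have [b1 [h1' [hp1 cov1]]] := rectify_complement pp g'0 lt2L sBA neBA P0 PL
    (leq_trans leL leSS) cov' leu (fun i lti => subsetP sSS _ (Iu i lti)) small dens.
  by exists b1, g', h1'.
have smallA : (#|sumset A| + 4 <= 3 * #|A|)%N.
  by have := subset_leq_card sBA; clear -small; lia.
have [b' [g' [L [u [g'0 lt2L [_ _ leL] cov' [leu Iu]]]]]] :=
  rectified_3k4 pp g10 hp1 cov1 n2 smallA.
have [l lE] : exists l, l.+1 = (2 * #|A|)%N by exists (2 * #|A| - 1)%N; clear -n0; lia.
rewrite -lE subn1 /= in leu Iu.
have lp : (l <= p)%N by clear -leu lt2L; lia.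
pose PA := [set b' + g' *+ (nat_of_ord i) | i : 'I_L.+1].
pose P2A := [set b' + b' + g' *+ u + g' *+ (nat_of_ord i) | i : 'I_l].
exists PA, P2A, g'; split; [|split; [|split; [|split; [|split]]]].
- by split=> //; exists b', L.+1; split=> //; clear -lt2L; lia.
- split=> //; exists (b' + b' + g' *+ u), l; split=> //.
  by rewrite lp andbT; clear -lE n0; lia.
- apply/subsetP => x /cov' [i leiL ->].
  by apply/imsetP; exists (Ordinal (leiL : (i < L.+1)%N)).
(* [L + 1 <= |2A| - |A| + 1], which is [|A| + r + 1]. *)
- have cPA : (#|PA| <= L.+1)%N by rewrite -[leqRHS]card_ord leq_imset_card.
  move: cPA leL; rewrite /r; move: #|PA| #|A| #|sumset A| => c n s; clear; lia.
- apply/subsetP => _ /imsetP[i _ ->]; rewrite -addrA -mulrnDr; exact: Iu.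
have -> : #|P2A| = l.
  rewrite card_imset ?card_ord // => i j /addrI eij; apply/val_inj.
  by apply: (Fp_muln_inj pp g'0 _ _ eij); apply: leq_trans lp.
by clear -lE; lia.
Qed.
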